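(* For $n\ge2$, the kernel of the welded three variable Tong-Yang-Ma representation $w\mathcal{TYM}\colon w\mathcal{SL}_n\to\mathrm{GL}_n(\mathbb{Z}[\widetilde\Lambda])$ is $$\ker w\mathcal{TYM}=\Bigl\{L\in w\mathcal{SL}_n\ \Bigm|\ \text{for each }1\le j\le n,\ \sum_{i=1,i\ne j}^{n}v\ell_{ij}(L)=\sum_{i=1,i\ne j}^{n}v\ell_{ji}(L)=\sum_{i=1,i\ne j}^{n}V_{ij}(L)=0\Bigr\}.$$
   Context: Welded string links. Fix reals $0<z_1<\dots<z_n<1$. A virtual $n$-string link diagram is an immersion of $n$ oriented intervals in $[0,1]\times[0,1]$ such that each initial point is some $z_i\times\{0\}$ (drawn at the top) and each endpoint some $z_j\times\{1\}$ (drawn at the bottom), whose singularities are finitely many transverse double points, each labelled as a positive crossing, a negative crossing (classical crossings) or a virtual crossing. The interval starting at $z_i\times\{0\}$ is the $i$-th string. A welded $n$-string link is an equivalence class of such diagrams under planar isotopy, the Reidemeister moves R1, R2, R3, the virtual Reidemeister moves (the analogues of R1, R2, R3 with all crossings virtual), the mixed move (a strand with only virtual crossings moves across a classical crossing), and the over-commute (OC) move (a strand passing over two others moves across a virtual crossing of those two). Welded $n$-string links form a monoid $w\mathcal{SL}_n$ under concatenation. Linking numbers. For $i\ne j$, $v\ell_{ij}(L)$ is the sum of the signs of the classical crossings where the $i$-th string passes over the $j$-th string. At a virtual crossing, rotated so that both strings point downwards, one string passes the other from left to right and the other passes from right to left; the virtual linking number $V_{ij}(L)$ is the number of virtual crossings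 where the $i$-th string passes the $j$-th string from right to left minus the number of those where the $i$-th string passes the $j$-th string from left to right (so $V_{ij}=-V_{ji}$). The representation. $\widetilde\Lambda$ is the free abelian group (written multiplicatively) on $u,v,\alpha$. A $\widetilde\Lambda$-group is a group with a right action of $\widetilde\Lambda$ by automorphisms, $(g,w)\mapsto g^w$; in a $\widetilde\Lambda$-presentation each $\widetilde\Lambda$-generator stands for a family of generators indexed by $\widetilde\Lambda$ and permuted by translation, and each relation stands for all its translates. Let $D$ be a diagram of $L$. Cut every string at every crossing (classical over, classical under, and virtual) and label the resulting edges; the top edges are $a_1,\dots,a_n$ and the bottom edges $x_1,\dots,x_n$ from left to right (if the same edge is top edge $i$ and bottom edge $j$, impose $x_j=a_i$). $wK$ is the $\widetilde\Lambda$-group with these labels as generators and relations: at a classical crossing of sign $\varepsilon$, if the under-string enters along $e$ and leaves along $e'$ and the over-string enters along $f$ and leaves along $f'$, then $e'=e^{u^{\varepsilon}}$ and $f'=f^{v^{\varepsilon}}$; at a virtual crossing, if the string passing from left to right enters along $e$ and leaves along $e'$ and the string passing from right to left enters along $f$ and leaves along $f'$, then $e'=e^{\alpha^{-1}}$ and $f'=f^{\alpha}$. Eliminating, $wK=\langle a_1,\dots,a_n,x_1,\dots,x_n\mid x_j=a_{i_j}^{w_j},\ 1\le j\le n\rangle$, where the $i_j$-th string ends at $z_j\times\{1\}$ and $w_j\in\widetilde\Lambda$. Let $w\widetilde K=\langle a_1,\dots,a_n,x_1,\dots,x_n\mid x_j=a_{i_j}^{w_j(uv)^{-k_j}},\ 1\le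 j\le n\rangle$, where $k_j$ is the sum of the signs of the classical self-crossings of the $i_j$-th string. Its abelianization is a free $\mathbb{Z}[\widetilde\Lambda]$-module with ordered bases $\mathcal S=(a_1,\dots,a_n)$ and $\mathcal T=(x_1,\dots,x_n)$, and $w\mathcal{TYM}(L)$ is the change of basis matrix with $\mathcal S\,w\mathcal{TYM}(L)=\mathcal T$. The map $w\mathcal{TYM}$ is a well-defined monoid homomorphism; its kernel is the preimage of the identity matrix. *)

(* Defs.v *)
From HB Require Import structures.
From mathcomp Require Import all_boot all_order all_algebra.
From mathcomp Require Import finmap monalg.
From mathcomp Require Import boolp classical_sets.

Set Implicit Arguments.
Unset Strict Implicit.
Unset Printing Implicit Defensive.

Import GRing.Theory.
Local Open Scope ring_scope.

(* A is written additively: << k >> is the element of the group ring given by *)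
(* k, and << k >> * << l >> = << k + l >>.  monalg only provides the ring     *)
(* structure over monoids without nontrivial invertible elements, so the      *)
(* product is defined here.                                                   *)
Definition group_ring (A : zmodType) : Type := {malg int[A]}.

Section GroupRing.
Variable A : zmodType.
Implicit Types (g : {malg int[A]}) (k : A).

Definition gr_one : {malg int[A]} := << (0 : A) >>.

Definition gr_mul g1 g2 : {malg int[A]} :=
  \sum_(k1 <- msupp g1) \sum_(k2 <- msupp g2)
    << g1@_k1 * g2@_k2 *g (k1 + k2 : A) >>.

Lemma gr_mulw (d1 d2 : {fset A}) g1 g2 :
  (msupp g1 `<=` d1)%fset -> (msupp g2 `<=` d2)%fset ->
  gr_mul g1 g2 = \sum_(k1 <- d1) \sum_(k2 <- d2)
    << g1@_k1 * g2@_k2 *g (k1 + k2 : A) >>.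
Proof.
move=> le1 le2; rewrite /gr_mul (big_fset_incl _ le1) /=.
  apply/eq_bigr=> k1 _; apply/big_fset_incl => // k _ /mcoeff_outdom ->.
  by rewrite mulr0 monalgU0.
move=> k _ /mcoeff_outdom g1k.
by rewrite big1 => // k' _; rewrite g1k mul0r monalgU0.
Qed.

Lemma gr_mulC : commutative gr_mul.
Proof.
move=> g1 g2; rewrite /gr_mul exchange_big /=.
by apply: eq_bigr => k1 _; apply: eq_bigr => k2 _; rewrite mulrC addrC.
Qed.

Lemma gr_mulUU c1 c2 k1 k2 :
  gr_mul << c1 *g k1 >> << c2 *g k2 >> = << c1 * c2 *g (k1 + k2 : A) >>.
Proof. by rewrite (gr_mulw msuppU_le msuppU_le) !big_seq_fset1 !mcoeffUU. Qed.

Lemma gr_mul0g : left_zero 0 gr_mul.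
Proof. by move=> g; rewrite /gr_mul msupp0 big_seq_fset0. Qed.

Lemma gr_mulDl : left_distributive gr_mul +%R.
Proof.
move=> g1 g2 g.
rewrite [in RHS](gr_mulw (fsubsetUl _ (msupp g2)) (fsubset_refl _)).
rewrite [in RHS](gr_mulw (fsubsetUr (msupp g1) _) (fsubset_refl _)).
rewrite (gr_mulw (msuppD_le _ _) (fsubset_refl _)).
rewrite -big_split /=; apply/eq_bigr=> k1 _.
rewrite -big_split /=; apply/eq_bigr=> k2 _.
by rewrite mcoeffD mulrDl monalgUD.
Qed.

Lemma gr_mulDr : right_distributive gr_mul +%R.
Proof. by move=> g g1 g2; rewrite !(gr_mulC g) gr_mulDl. Qed.

Lemma gr_mulg0 : right_zero 0 gr_mul.
Proof. by move=> g; rewrite gr_mulC gr_mul0g. Qed.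

Lemma gr_mul_suml (I : Type) (r : seq I) (F : I -> {malg int[A]}) g :
  gr_mul (\sum_(i <- r) F i) g = \sum_(i <- r) gr_mul (F i) g.
Proof. exact: (big_morph (gr_mul^~ g) (fun x y => gr_mulDl x y g) (gr_mul0g g)). Qed.

Lemma gr_mul_sumr (I : Type) (r : seq I) (F : I -> {malg int[A]}) g :
  gr_mul g (\sum_(i <- r) F i) = \sum_(i <- r) gr_mul g (F i).
Proof. exact: (big_morph (gr_mul g) (gr_mulDr g) (gr_mulg0 g)). Qed.

Lemma gr_mulA : associative gr_mul.
Proof.
move=> g1 g2 g3; rewrite [g1]monalgE gr_mul_suml [gr_mul _ g2]gr_mul_suml.
rewrite gr_mul_suml; apply: eq_bigr => k1 _.
rewrite [g2]monalgE gr_mul_suml !gr_mul_sumr gr_mul_suml.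
apply: eq_bigr => k2 _.
rewrite [g3]monalgE !gr_mul_sumr; apply: eq_bigr => k3 _.
by rewrite !gr_mulUU mulrA addrA.
Qed.

Lemma gr_mul1g : left_id gr_one gr_mul.
Proof.
move=> g; rewrite {1}[g]monalgE gr_mul_sumr [RHS]monalgE.
by apply: eq_bigr => k _; rewrite gr_mulUU mul1r add0r.
Qed.

Lemma gr_one_neq0 : gr_one != 0.
Proof. by rewrite monalgU_eq0. Qed.

HB.instance Definition _ := GRing.Zmodule.on (group_ring A).
HB.instance Definition _ := GRing.Zmodule_isComNzRing.Build (group_ring A)
  gr_mulA gr_mulC gr_mul1g gr_mulDl gr_one_neq0.

End GroupRing.

Record actGroup (A : zmodType) := ActGroup {
  agroup :> groupType;
  aact : agroup -> A -> agroup;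
  aactM : forall w, {morph aact^~ w : g h / (g * h)%g};
  aact0 : forall g, aact g 0 = g;
  aactD : forall g w1 w2, aact (aact g w1) w2 = aact g (w1 + w2)
}.

(* The letter (x, w, b) stands for x^w if b and for its inverse otherwise;    *)
(* the A-generator x stands for all x^w, and each relation for all its        *)
(* translates.                                                                *)
Section Presentation.
Variables (A : zmodType) (X : choiceType).

Definition letter : Type := (X * A * bool)%type.
Definition word : Type := seq letter.
HB.instance Definition _ := Choice.on word.

Definition inv_letter (l : letter) : letter := (l.1, ~~ l.2).
Definition inv_word (s : word) : word := rev (map inv_letter s).
Definition translate (w : A) (s : word) : word :=
  [seq (l.1.1, l.1.2 + w, l.2) | l <- s].

Variable R : word -> word -> Prop.

Inductive pres_eq : word -> word -> Prop :=
| PE_refl s : pres_eq s s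
| PE_sym s t : pres_eq s t -> pres_eq t s
| PE_trans s t r : pres_eq s t -> pres_eq t r -> pres_eq s r
| PE_cat s s' t t' : pres_eq s s' -> pres_eq t t' -> pres_eq (s ++ t) (s' ++ t')
| PE_cancel l : pres_eq [:: l; inv_letter l] [::]
| PE_rel s t w : R s t -> pres_eq (translate w s) (translate w t).

Definition pres_rel (s t : word) : bool := `[< pres_eq s t >].

Lemma pres_rel_refl : reflexive pres_rel.
Proof. by move=> s; apply/asboolP; constructor. Qed.
Lemma pres_rel_sym : symmetric pres_rel.
Proof. by move=> s t; apply/asbool_equiv_eq; split; apply: PE_sym. Qed.
Lemma pres_rel_trans : transitive pres_rel.
Proof.
by move=> t s r /asboolP st /asboolP tr; apply/asboolP; apply: PE_trans st tr.
Qed.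

Canonical pres_equiv :=
  EquivRel pres_rel pres_rel_refl pres_rel_sym pres_rel_trans.

Definition pres_group : Type := {eq_quot pres_equiv}%qT.
HB.instance Definition _ := Choice.on pres_group.
HB.instance Definition _ := EqQuotient.on pres_group.

Definition pres_cls (s : word) : pres_group := \pi_pres_group%qT s.

Lemma pres_clsP s t : pres_cls s = pres_cls t <-> pres_eq s t.
Proof.
by split=> [/eqquotP/asboolP|st] //; apply/eqquotP/asboolP.
Qed.

Lemma pres_reprK (x : pres_group) : pres_cls (repr x) = x.
Proof. exact: reprK. Qed.

Lemma pres_repr s : pres_eq (repr (pres_cls s)) s.
Proof. by apply/pres_clsP; rewrite pres_reprK. Qed.

Definition pres_one : pres_group := pres_cls [::].
Definition pres_mul (x y : pres_group) := pres_cls (repr x ++ repr y).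
Definition pres_inv (x : pres_group) := pres_cls (inv_word (repr x)).
Definition pres_act (x : pres_group) (w : A) := pres_cls (translate w (repr x)).

Lemma inv_letterK : involutive inv_letter.
Proof. by case=> p b; rewrite /inv_letter /= negbK. Qed.

Lemma inv_word_cat s t : inv_word (s ++ t) = inv_word t ++ inv_word s.
Proof. by rewrite /inv_word map_cat rev_cat. Qed.

Lemma inv_word_cons l s : inv_word (l :: s) = inv_word s ++ [:: inv_letter l].
Proof. by rewrite /inv_word /= rev_cons cats1. Qed.

Lemma inv_wordK : involutive inv_word.
Proof.
by move=> s; rewrite /inv_word map_rev revK -map_comp map_id_in // => l _ /=;
   rewrite inv_letterK.
Qed.

Lemma pres_mulV s : pres_eq (s ++ inv_word s) [::].
Proof.
elim: s => [|l s IH]; first exact: PE_refl.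
rewrite inv_word_cons -cat1s -catA (catA s).
apply: PE_trans (PE_cancel l).
apply: (@PE_cat [:: l] [:: l] _ [:: inv_letter l]); first exact: PE_refl.
exact: (@PE_cat _ [::] _ _ IH (PE_refl _)).
Qed.

Lemma translate_cat w s t : translate w (s ++ t) = translate w s ++ translate w t.
Proof. exact: map_cat. Qed.

Lemma translate0 s : translate 0 s = s.
Proof. by rewrite /translate map_id_in // => [[[x a] b]] _ /=; rewrite addr0. Qed.

Lemma translateD w1 w2 s : translate w2 (translate w1 s) = translate (w1 + w2) s.
Proof. by rewrite /translate -map_comp; apply: eq_map => l /=; rewrite addrA. Qed.

Lemma pres_eq_translate w s t :
  pres_eq s t -> pres_eq (translate w s) (translate w t).
Proof.
elim=> {s t}.
- by move=> s; exact: PE_refl.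
- by move=> s t _; exact: PE_sym.
- by move=> s t r _ IH1 _; exact: PE_trans.
- by move=> s s' t t' _ IH1 _ IH2; rewrite !translate_cat; exact: PE_cat.
- by move=> l; exact: (PE_cancel (l.1.1, l.1.2 + w, l.2)).
- by move=> s t w' Rst; rewrite !translateD; exact: PE_rel.
Qed.

Lemma pres_eq_inv s t : pres_eq s t -> pres_eq (inv_word s) (inv_word t).
Proof.
move=> st; have h : pres_eq (inv_word s ++ (t ++ inv_word t)) (inv_word s).
  rewrite -[X in pres_eq _ X]cats0.
  by apply: PE_cat; [exact: PE_refl | exact: pres_mulV].
apply: PE_trans (PE_sym h) _; rewrite catA -[X in pres_eq _ X]cat0s.
apply: PE_cat; last exact: PE_refl.
apply: PE_trans (pres_mulV (inv_word s)); rewrite inv_wordK.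
by apply: PE_cat; [exact: PE_refl | exact: PE_sym].
Qed.

Lemma pres_mulE s t : pres_mul (pres_cls s) (pres_cls t) = pres_cls (s ++ t).
Proof. by apply/pres_clsP; apply: PE_cat; exact: pres_repr. Qed.

Lemma pres_invE s : pres_inv (pres_cls s) = pres_cls (inv_word s).
Proof. by apply/pres_clsP; apply: pres_eq_inv; exact: pres_repr. Qed.

Lemma pres_actE s w : pres_act (pres_cls s) w = pres_cls (translate w s).
Proof. by apply/pres_clsP; apply: pres_eq_translate; exact: pres_repr. Qed.

Lemma pres_ind (P : pres_group -> Prop) :
  (forall s, P (pres_cls s)) -> forall x, P x.
Proof. by move=> h x; rewrite -(pres_reprK x). Qed.

Lemma pres_mulgA : associative pres_mul.
Proof.
by elim/pres_ind=> s; elim/pres_ind=> t; elim/pres_ind=> r;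
   rewrite !pres_mulE catA.
Qed.
Lemma pres_mul1g : left_id pres_one pres_mul.
Proof. by elim/pres_ind=> s; rewrite pres_mulE. Qed.
Lemma pres_mulg1 : right_id pres_one pres_mul.
Proof. by elim/pres_ind=> s; rewrite pres_mulE cats0. Qed.
Lemma pres_mulgV : right_inverse pres_one pres_inv pres_mul.
Proof.
by elim/pres_ind=> s; rewrite pres_invE pres_mulE; apply/pres_clsP/pres_mulV.
Qed.
Lemma pres_mulVg : left_inverse pres_one pres_inv pres_mul.
Proof.
elim/pres_ind=> s; rewrite pres_invE pres_mulE; apply/pres_clsP.
by rewrite -{2}[s]inv_wordK; apply: pres_mulV.
Qed.

HB.instance Definition _ := isGroup.Build pres_group
  pres_mulgA pres_mul1g pres_mulg1 pres_mulVg pres_mulgV.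

Lemma pres_actM w : {morph pres_act^~ w : g h / (g * h)%g}.
Proof.
elim/pres_ind=> s; elim/pres_ind=> t.
rewrite -[(_ * _)%g in LHS]/(pres_mul _ _) -[RHS]/(pres_mul _ _).
by rewrite !(pres_mulE, pres_actE) translate_cat.
Qed.
Lemma pres_act0 g : pres_act g 0 = g.
Proof. by elim/pres_ind: g => s; rewrite pres_actE translate0. Qed.
Lemma pres_actD g w1 w2 : pres_act (pres_act g w1) w2 = pres_act g (w1 + w2).
Proof. by elim/pres_ind: g => s; rewrite !pres_actE translateD. Qed.

Definition presented : actGroup A :=
  @ActGroup A pres_group pres_act pres_actM pres_act0 pres_actD.

Definition pres_gen (x : X) : presented := pres_cls [:: (x, 0, true)].

End Presentation.

Section Abelianization.
Variables (A : zmodType) (G : actGroup A).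
Local Open Scope group_scope.

Inductive in_derived : G -> Prop :=
| ID_one : in_derived 1
| ID_comm g h : in_derived [~ g, h]
| ID_mul g h : in_derived g -> in_derived h -> in_derived (g * h)
| ID_inv g : in_derived g -> in_derived g^-1.

Definition ab_rel (g h : G) : bool := `[< in_derived (g * h^-1) >].

Lemma ab_rel_refl : reflexive ab_rel.
Proof. by move=> g; apply/asboolP; rewrite mulgV; constructor. Qed.
Lemma ab_rel_sym : symmetric ab_rel.
Proof.
by move=> g h; apply/asbool_equiv_eq; split=> /ID_inv; rewrite invgM invgK.
Qed.
Lemma ab_rel_trans : transitive ab_rel.
Proof.
move=> h g k /asboolP gh /asboolP hk; apply/asboolP.
by have := ID_mul gh hk; rewrite -mulgA mulKg.
Qed.

Canonical ab_equiv := EquivRel ab_rel ab_rel_refl ab_rel_sym ab_rel_trans.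

Definition abel : Type := {eq_quot ab_equiv}%qT.
HB.instance Definition _ := Choice.on abel.
HB.instance Definition _ := EqQuotient.on abel.

Definition ab_cls (g : G) : abel := \pi_abel%qT g.

Lemma ab_clsP g h : ab_cls g = ab_cls h <-> in_derived (g * h^-1).
Proof. by split=> [/eqquotP/asboolP|gh] //; apply/eqquotP/asboolP. Qed.

Lemma ab_reprK (x : abel) : ab_cls (repr x) = x.
Proof. exact: reprK. Qed.

Lemma ab_repr g : in_derived (repr (ab_cls g) * g^-1).
Proof. by apply/ab_clsP; rewrite ab_reprK. Qed.

Lemma ab_ind (P : abel -> Prop) : (forall g, P (ab_cls g)) -> forall x, P x.
Proof. by move=> h x; rewrite -(ab_reprK x). Qed.

Lemma in_derivedJ g d : in_derived d -> in_derived (g * d * g^-1).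
Proof.
move=> dd; have -> : g * d * g^-1 = [~ g^-1, d^-1] * d; last first.
  by apply: ID_mul dd; exact: ID_comm.
by rewrite /commg /conjg !invgK !mulgA mulgVK.
Qed.

Definition ab_zero : abel := ab_cls 1.
Definition ab_add (x y : abel) := ab_cls (repr x * repr y).
Definition ab_opp (x : abel) := ab_cls (repr x)^-1.

Lemma ab_cls_mul g g' h h' : ab_cls g = ab_cls g' -> ab_cls h = ab_cls h' ->
  ab_cls (g * h) = ab_cls (g' * h').
Proof.
move=> /ab_clsP gg /ab_clsP hh; apply/ab_clsP.
have -> : g * h * (g' * h')^-1 = (g * (h * h'^-1) * g^-1) * (g * g'^-1).
  by rewrite invgM !mulgA mulgVK.
exact: ID_mul (in_derivedJ _ hh) gg.
Qed.

Lemma ab_addE g h : ab_add (ab_cls g) (ab_cls h) = ab_cls (g * h).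
Proof. by apply: ab_cls_mul; exact: ab_reprK. Qed.

Lemma ab_oppE g : ab_opp (ab_cls g) = ab_cls g^-1.
Proof.
apply/ab_clsP; have := in_derivedJ (repr (ab_cls g))^-1 (ID_inv (ab_repr g)).
by rewrite invgM !invgK !mulgA mulgVK.
Qed.

Lemma ab_addA : associative ab_add.
Proof.
by elim/ab_ind=> g; elim/ab_ind=> h; elim/ab_ind=> k; rewrite !ab_addE mulgA.
Qed.
Lemma ab_addC : commutative ab_add.
Proof.
elim/ab_ind=> g; elim/ab_ind=> h; rewrite !ab_addE; apply/ab_clsP.
have -> : g * h * (h * g)^-1 = [~ g^-1, h^-1].
  by rewrite /commg /conjg invgM !invgK !mulgA.
exact: ID_comm.
Qed.
Lemma ab_add0 : left_id ab_zero ab_add.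
Proof. by elim/ab_ind=> g; rewrite ab_addE mul1g. Qed.
Lemma ab_addN : left_inverse ab_zero ab_opp ab_add.
Proof. by elim/ab_ind=> g; rewrite ab_oppE ab_addE mulVg. Qed.

HB.instance Definition _ := GRing.isZmodule.Build abel
  ab_addA ab_addC ab_add0 ab_addN.

Lemma ab_clsM g h : ab_cls (g * h) = (ab_cls g + ab_cls h)%R.
Proof. by rewrite -ab_addE. Qed.

Lemma aact1 w : aact (1 : G) w = 1.
Proof.
by apply: (mulgI (aact (1 : G) w)); rewrite -aactM !mulg1.
Qed.
Lemma aactV (g : G) w : aact g^-1 w = (aact g w)^-1.
Proof.
by apply: (mulgI (aact g w)); rewrite -aactM !mulgV aact1.
Qed.

Lemma in_derived_act w g : in_derived g -> in_derived (aact g w).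
Proof.
elim=> {g}.
- by rewrite aact1; constructor.
- by move=> g h; rewrite /commg /conjg !(aactM, aactV); exact: ID_comm.
- by move=> g h _ IHg _ IHh; rewrite aactM; exact: ID_mul.
- by move=> g _ IH; rewrite aactV; exact: ID_inv.
Qed.

Definition ab_act (w : A) (x : abel) : abel := ab_cls (aact (repr x) w).

Lemma ab_actE w g : ab_act w (ab_cls g) = ab_cls (aact g w).
Proof.
by apply/ab_clsP; rewrite -aactV -aactM; apply/in_derived_act/ab_repr.
Qed.

Local Open Scope ring_scope.

Lemma ab_actB w : {morph ab_act w : x y / x - y}.
Proof.
elim/ab_ind=> g; elim/ab_ind=> h.
have opE k : - ab_cls k = ab_cls (k^-1)%g by rewrite -ab_oppE.
by rewrite opE -ab_clsM !ab_actE opE -ab_clsM aactM aactV.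
Qed.
HB.instance Definition _ w := GRing.isZmodMorphism.Build abel abel (ab_act w)
  (ab_actB w).

Lemma ab_act0 x : ab_act 0 x = x.
Proof. by elim/ab_ind: x => g; rewrite ab_actE aact0. Qed.
Lemma ab_actD w1 w2 x : ab_act w1 (ab_act w2 x) = ab_act (w1 + w2) x.
Proof. by elim/ab_ind: x => g; rewrite !ab_actE aactD addrC. Qed.

Definition ab_scale (c : group_ring A) (x : abel) : abel :=
  \sum_(k <- msupp (c : {malg int[A]})) ab_act k x *~ (c : {malg int[A]})@_k.

Lemma ab_scalew (c : {malg int[A]}) (d : {fset A}) x : (msupp c `<=` d)%fset ->
  ab_scale c x = \sum_(k <- d) ab_act k x *~ c@_k.
Proof.
move=> le; rewrite /ab_scale (big_fset_incl _ le) //= => k _ /mcoeff_outdom ->.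
by rewrite mulr0z.
Qed.

Lemma ab_scaleDl x : {morph ab_scale^~ x : c d / c + d}.
Proof.
move=> c d; rewrite [LHS](ab_scalew x (msuppD_le c d)).
rewrite [ab_scale c x](ab_scalew x (fsubsetUl _ (msupp (d : {malg int[A]})))).
rewrite [ab_scale d x](ab_scalew x (fsubsetUr (msupp (c : {malg int[A]})) _)).
by rewrite -big_split /=; apply: eq_bigr => k _; rewrite mcoeffD mulrzDr.
Qed.

Lemma ab_scale0l x : ab_scale 0 x = 0.
Proof. by rewrite /ab_scale msupp0 big_seq_fset0. Qed.

Lemma ab_scaleDr c : {morph ab_scale c : x y / x + y}.
Proof.
move=> x y; rewrite /ab_scale -big_split /=; apply: eq_bigr => k _.
by rewrite raddfD mulrzDl.
Qed.

Lemma ab_scale0r c : ab_scale c 0 = 0.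
Proof. by rewrite /ab_scale big1 // => k _; rewrite raddf0 mul0rz. Qed.

Lemma ab_scaleU (z : int) (w : A) x :
  ab_scale (<< z *g w >> : {malg int[A]}) x = ab_act w x *~ z.
Proof. by rewrite (ab_scalew x msuppU_le) big_seq_fset1 mcoeffUU. Qed.

Lemma ab_scale1 : left_id 1 ab_scale.
Proof. by move=> x; rewrite [LHS](ab_scaleU 1 0 x) ab_act0. Qed.

Lemma ab_scale_suml (I : Type) (r : seq I) (F : I -> {malg int[A]}) x :
  ab_scale (\sum_(i <- r) F i) x = \sum_(i <- r) ab_scale (F i) x.
Proof.
exact: (big_morph (ab_scale^~ x) (ab_scaleDl x) (ab_scale0l x)).
Qed.

Lemma ab_scale_sumr (I : Type) (r : seq I) (F : I -> abel) c :
  ab_scale c (\sum_(i <- r) F i) = \sum_(i <- r) ab_scale c (F i).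
Proof. exact: (big_morph (ab_scale c) (ab_scaleDr c) (ab_scale0r c)). Qed.

Lemma ab_scaleA c d x : ab_scale c (ab_scale d x) = ab_scale (c * d) x.
Proof.
transitivity (ab_scale (gr_mul c d) x); last by [].
rewrite [X in ab_scale X (ab_scale _ _)](monalgE (c : {malg int[A]})).
rewrite [X in gr_mul X _](monalgE (c : {malg int[A]})).
rewrite gr_mul_suml !ab_scale_suml; apply: eq_bigr => k _.
rewrite [X in ab_scale _ (ab_scale X _)](monalgE (d : {malg int[A]})).
rewrite [X in gr_mul _ X](monalgE (d : {malg int[A]})).
rewrite gr_mul_sumr !ab_scale_suml ab_scale_sumr; apply: eq_bigr => l _.
by rewrite gr_mulUU !ab_scaleU (raddfMz (ab_act k)) /= ab_actD -mulrzA mulrC.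
Qed.

HB.instance Definition _ := GRing.Zmodule_isLmodule.Build (group_ring A) abel
  ab_scaleA ab_scale1 ab_scaleDr ab_scaleDl.

End Abelianization.

(* A diagram in general position with respect to the height function is cut   *)
(* by horizontal lines into slices, read from top to bottom, each containing  *)
(* one elementary piece: a crossing, a local maximum (Cap) or a local minimum *)
(* (Cup).  The slice (g, i) has its piece at the positions i, i+1 (positions  *)
(* are counted from 0, from the left) and vertical strands elsewhere.         *)
(* The label of a crossing tells how the strand from the upper left to the    *)
(* lower right passes the other one; together with the orientations this      *)
(* amounts to the labels "positive", "negative", "virtual" (see csign below). *)
Inductive clabel := Over | Under | Virt.
Inductive piece := Cross of clabel | Cap | Cup.

Definition clabel_code (l : clabel) : option bool :=
  match l with Over => Some true | Under => Some false | Virt => None end.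
Definition clabel_decode (b : option bool) : clabel :=
  match b with Some true => Over | Some false => Under | None => Virt end.
Lemma clabel_codeK : cancel clabel_code clabel_decode. Proof. by case. Qed.
HB.instance Definition _ := Countable.copy clabel (can_type clabel_codeK).

Definition piece_code (g : piece) : clabel + bool :=
  match g with Cross l => inl l | Cap => inr true | Cup => inr false end.
Definition piece_decode (x : clabel + bool) : piece :=
  match x with inl l => Cross l | inr true => Cap | inr false => Cup end.
Lemma piece_codeK : cancel piece_code piece_decode. Proof. by case. Qed.
HB.instance Definition _ := Countable.copy piece (can_type piece_codeK).

Definition slice : Type := (piece * nat)%type.

Section Combinatorics.
Local Open Scope nat_scope.

Definition strands_in (g : piece) : nat := if g is Cap then 0 else 2.
Definition strands_out (g : piece) : nat := if g is Cup then 0 else 2.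

Fixpoint fits (m : nat) (w : seq slice) (m' : nat) : bool :=
  if w is s :: w' then
    (s.2 + strands_in s.1 <= m) && fits (m - strands_in s.1 + strands_out s.1) w' m'
  else m == m'.

Variables (n : nat) (w : seq slice).

(* The number of points of the diagram on the k-th cutting line. *)
Definition width (k : nat) : nat :=
  foldl (fun m s => m - strands_in s.1 + strands_out s.1) n (take k w).

(* A node (k, p) is the p-th point on the k-th cutting line; in (k, p, d) it  *)
(* is run through downwards if d, upwards otherwise.                          *)
Definition node : Type := (nat * nat)%type.
Definition is_node (x : node) : bool := (x.1 <= size w) && (x.2 < width x.1).

Definition slice_at (k : nat) : slice := nth (Cap, 0) w k.

(* Entering the slice s from above at position p, one leaves it at position   *)
(* (pass s p).1, through the bottom if (pass s p).2 and through the top       *)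
(* otherwise.                                                                 *)
Definition pass (s : slice) (p : nat) : nat * bool :=
  let i := s.2 in
  match s.1 with
  | Cross _ => (if p == i then i.+1 else if p == i.+1 then i else p, true)
  | Cap => (if p < i then p else p.+2, true)
  | Cup => if p == i then (i.+1, false) else if p == i.+1 then (i, false)
           else (if p < i then p else p - 2, true)
  end.

Definition mirror (s : slice) : slice :=
  (match s.1 with Cap => Cup | Cup => Cap | Cross l => Cross l end, s.2).

Definition step (x : node * bool) : option (node * bool) :=
  let: (k, p, d) := x in
  if d then
    if k < size w then
      let: (q, through) := pass (slice_at k) p in
      Some (if through then (k.+1, q, true) else (k, q, false))
    else None
  else
    if k is k'.+1 then
      let: (q, through) := pass (mirror (slice_at k')) p in
      Some (if through then (k', q, false) else (k, q, true))
    else None.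

(* The oriented nodes met along the string starting at the j-th top point;    *)
(* the bound is the total number of oriented nodes.                           *)
Definition trace (j : nat) : seq (node * bool) :=
  pmap id (traject (obind step) (Some (0, j, true))
                   (2 * sumn [seq width k | k <- iota 0 (size w).+1])).

Definition all_nodes : seq node :=
  [seq (k, p) | k <- iota 0 (size w).+1, p <- iota 0 (width k)].

(* The diagram is an immersion of n intervals, each running from a top point  *)
(* to a bottom point: every string ends at the bottom, and the strings cover  *)
(* the diagram, so that it has no closed component.                           *)
Definition string_link : bool :=
  [&& fits n w n,
      all (fun j => has (fun x => (x.1.1 == size w) && x.2) (trace j)) (iota 0 n)
    & all (fun x => has (fun j => ((x, true) \in trace j) || ((x, false) \in trace j))
                        (iota 0 n)) all_nodes].

Definition downward (x : node) : bool :=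
  has (fun j => (x, true) \in trace j) (iota 0 n).

Definition string_through (x : node) : option nat :=
  ohead [seq j <- iota 0 n | ((x, true) \in trace j) || ((x, false) \in trace j)].

(* The two strands of a crossing slice: UL runs between the upper left and    *)
(* the lower right, UR between the upper right and the lower left.            *)
Definition stringUL (k : nat) := string_through (k, (slice_at k).2).
Definition stringUR (k : nat) := string_through (k, (slice_at k).2.+1).

Definition parallel (k : nat) : bool :=
  downward (k, (slice_at k).2) == downward (k, (slice_at k).2.+1).

Definition classical (k : nat) : bool :=
  ((slice_at k).1 == Cross Over) || ((slice_at k).1 == Cross Under).
Definition virtual (k : nat) : bool := (slice_at k).1 == Cross Virt.

Definition over_string (k : nat) :=
  if (slice_at k).1 == Cross Over then stringUL k else stringUR k.
Definition under_string (k : nat) :=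
  if (slice_at k).1 == Cross Over then stringUR k else stringUL k.

(* If both strands of a crossing point downwards, UL passes UR from left to   *)
(* right; reversing both strands does not change this, reversing one of them  *)
(* exchanges the roles.                                                       *)
Definition ltr_string (k : nat) := if parallel k then stringUL k else stringUR k.
Definition rtl_string (k : nat) := if parallel k then stringUR k else stringUL k.

(* A crossing is positive when the over-strand passes the under-strand from   *)
(* right to left, both pointing downwards.                                    *)
Definition csign (k : nat) : int :=
  match (slice_at k).1 with
  | Cross Over => if parallel k then (-1)%R else 1%R
  | Cross Under => if parallel k then 1%R else (-1)%R
  | _ => 0%R
  end.

End Combinatorics.

Definition diagram (n : nat) : Type := {w : seq slice | string_link n w}.
HB.instance Definition _ n := Choice.on (diagram n).

Definition flip (l : clabel) : clabel :=
  match l with Over => Under | Under => Over | Virt => Virt end.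

Definition is_classical (l : clabel) : bool := if l is Virt then false else true.

(* (a, b, c) are the labels of the crossings of the strands 12, 13, 23, which *)
(* are numbered from the left at the top.  In R3 all crossings are classical  *)
(* and the relation "over" between the strands is not cyclic.                 *)
Definition R3_labels (a b c : clabel) : bool :=
  [&& is_classical a, is_classical b, is_classical c
    & ~~ ((a == c) && (b == flip a))].
Definition virtual_R3_labels (a b c : clabel) : bool :=
  [&& a == Virt, b == Virt & c == Virt].
Definition mixed_labels (a b c : clabel) : bool :=
  [|| [&& is_classical a, b == Virt & c == Virt],
      [&& a == Virt, is_classical b & c == Virt]
    | [&& a == Virt, b == Virt & is_classical c]].
(* Over-commute: strand 1, 2 or 3, respectively, passes over the two others,  *)
(* whose crossing is virtual.                                                 *)
Definition OC_labels (a b c : clabel) : bool :=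
  [|| [&& a == Over, b == Over & c == Virt],
      [&& a == Under, b == Virt & c == Over]
    | [&& a == Virt, b == Under & c == Under]].

Inductive move : seq slice -> seq slice -> Prop :=
(* planar isotopy: change of relative height, cancellation of a maximum with  *)
(* a minimum, and sliding a strand past a maximum or a minimum                *)
| M_exchange (g h : piece) (i k : nat) :
    move [:: (h, i + strands_in g + k)%N; (g, i)]
         [:: (g, i); (h, i + strands_out g + k)%N]
| M_zigzagl i : move [:: (Cap, i.+1); (Cup, i)] [::]
| M_zigzagr i : move [:: (Cap, i); (Cup, i.+1)] [::]
| M_slide_cap l i :
    move [:: (Cap, i.+1); (Cross l, i)] [:: (Cap, i); (Cross (flip l), i.+1)]
| M_slide_cup l i :
    move [:: (Cross l, i); (Cup, i.+1)] [:: (Cross (flip l), i.+1); (Cup, i)]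
(* classical and virtual R1 and R2 *)
| M_R1_cap l i : move [:: (Cap, i); (Cross l, i)] [:: (Cap, i)]
| M_R1_cup l i : move [:: (Cross l, i); (Cup, i)] [:: (Cup, i)]
| M_R2 l i : move [:: (Cross l, i); (Cross (flip l), i)] [::]
(* classical and virtual R3, mixed move, OC *)
| M_triangle a b c i :
    [|| R3_labels a b c, virtual_R3_labels a b c, mixed_labels a b c
      | OC_labels a b c] ->
    move [:: (Cross a, i); (Cross b, i.+1); (Cross c, i)]
         [:: (Cross c, i.+1); (Cross b, i); (Cross a, i.+1)].

Section Welded.
Variable n : nat.

Inductive welded_eq : diagram n -> diagram n -> Prop :=
| WE_move (D E : diagram n) w1 w2 l r : move l r ->
    val D = w1 ++ l ++ w2 -> val E = w1 ++ r ++ w2 -> welded_eq D E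
| WE_refl D : welded_eq D D
| WE_sym D E : welded_eq D E -> welded_eq E D
| WE_trans D E F : welded_eq D E -> welded_eq E F -> welded_eq D F.

Definition welded_rel (D E : diagram n) : bool := `[< welded_eq D E >].

Lemma welded_rel_refl : reflexive welded_rel.
Proof. by move=> D; apply/asboolP; exact: WE_refl. Qed.
Lemma welded_rel_sym : symmetric welded_rel.
Proof. by move=> D E; apply/asbool_equiv_eq; split; exact: WE_sym. Qed.
Lemma welded_rel_trans : transitive welded_rel.
Proof.
by move=> D E F /asboolP DE /asboolP EF; apply/asboolP; exact: WE_trans DE EF.
Qed.

Canonical welded_equiv :=
  EquivRel welded_rel welded_rel_refl welded_rel_sym welded_rel_trans.

Definition wSL : Type := {eq_quot welded_equiv}%qT.
HB.instance Definition _ := Choice.on wSL.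
HB.instance Definition _ := EqQuotient.on wSL.

End Welded.

Section Linking.
Variables (n : nat) (D : diagram n).
Let w : seq slice := val D.

Definition vlk_diag (i j : 'I_n) : int :=
  \sum_(k < size w | [&& classical w k, over_string n w k == Some (i : nat)
                       & under_string n w k == Some (j : nat)]) csign n w k.

Definition V_diag (i j : 'I_n) : int :=
  \sum_(k < size w | [&& virtual w k, rtl_string n w k == Some (i : nat)
                       & ltr_string n w k == Some (j : nat)]) 1
  - \sum_(k < size w | [&& virtual w k, ltr_string n w k == Some (i : nat)
                         & rtl_string n w k == Some (j : nat)]) 1.

Definition self_crossings (i : 'I_n) : int :=
  \sum_(k < size w | [&& classical w k, over_string n w k == Some (i : nat)
                       & under_string n w k == Some (i : nat)]) csign n w k.

End Linking.

(* The free abelian group on u, v, alpha is written additively as             *)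
(* Z^3: u^p v^q alpha^r is (p, q, r).                                         *)
Definition Lam : zmodType := (int * int * int)%type.
Definition lam_u : Lam := (1, 0, 0).
Definition lam_v : Lam := (0, 1, 0).
Definition lam_alpha : Lam := (0, 0, 1).

(* The exponent picked up by a string in passing from the oriented node x to  *)
(* the next one, through the slice below x or above x.                        *)
Definition pass_exp (n : nat) (w : seq slice) (x : node * bool) : Lam :=
  let: (k, p, d) := x in
  let k' := if d then k else k.-1 in
  let i := (slice_at w k').2 in
  let onUL := p == (if d then i else i.+1) in
  let onUR := p == (if d then i.+1 else i) in
  let e := csign n w k' in
  match (slice_at w k').1 with
  | Cross Over => if onUL then lam_v *~ e else if onUR then lam_u *~ e else 0
  | Cross Under => if onUL then lam_u *~ e else if onUR then lam_v *~ e else 0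
  | Cross Virt =>
      if onUL then (if parallel n w k' then - lam_alpha else lam_alpha)
      else if onUR then (if parallel n w k' then lam_alpha else - lam_alpha)
      else 0
  | _ => 0
  end.

Section Representation.
Variables (n : nat) (D : diagram n).
Let w : seq slice := val D.

(* The nodes of the diagram are the labels.  The strings are thus cut at each *)
(* crossing and moreover at the cutting lines; pieces of the same edge are    *)
(* identified by the relations with pass_exp = 0.                             *)
Definition edge : Type := {x : node | is_node n w x}.
HB.instance Definition _ := Choice.on edge.

Lemma fits_width m v m' : fits m v m' ->
  foldl (fun m s => (m - strands_in s.1 + strands_out s.1)%N) m v = m'.
Proof. by elim: v m => [|s v IH] m /= => [/eqP|/andP[_ /IH]]. Qed.

Lemma top_node_subproof (i : 'I_n) : is_node n w (0%N, i : nat).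
Proof. by rewrite /is_node /= /width take0 /=. Qed.
Lemma bottom_node_subproof (j : 'I_n) : is_node n w (size w, j : nat).
Proof.
rewrite /is_node /= leqnn /width take_size /=.
by have /and3P[/fits_width-> _ _] : string_link n w := valP D.
Qed.

Definition top_edge (i : 'I_n) : edge := Sub _ (top_node_subproof i).
Definition bottom_edge (j : 'I_n) : edge := Sub _ (bottom_node_subproof j).

Inductive wK_rel : word Lam edge -> word Lam edge -> Prop :=
| WK_pass (j : 'I_n) (x y : node * bool) (e e' : edge) :
    x \in trace n w j -> step w x = Some y -> val e = x.1 -> val e' = y.1 ->
    wK_rel [:: (e', 0, true)] [:: (e, pass_exp n w x, true)].

Definition wK : actGroup Lam := presented wK_rel.

(* The index i_j; exactly one string ends at each bottom point, so the        *)
(* default value is not used.                                                 *)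
Definition string_to (j : 'I_n) : 'I_n :=
  odflt j [pick i : 'I_n | (size w, j : nat, true) \in trace n w i].

(* The exponent w_j, for which x_j = a_{i_j}^{w_j} in wK. *)
Definition wexp (j : 'I_n) : Lam :=
  xget 0 [set l | pres_gen wK_rel (bottom_edge j)
                  = aact (pres_gen wK_rel (top_edge (string_to j)) : wK) l].

(* inl i is a_i and inr j is x_j. *)
Inductive wKt_rel : word Lam ('I_n + 'I_n)%type -> word Lam ('I_n + 'I_n)%type -> Prop :=
| WKt_end (j : 'I_n) :
    wKt_rel [:: (inr j, 0, true)]
            [:: (inl (string_to j),
                 wexp j - (lam_u + lam_v) *~ self_crossings D (string_to j), true)].

Definition wKt : actGroup Lam := presented wKt_rel.

Definition wKt_a (i : 'I_n) : abel wKt := ab_cls (pres_gen wKt_rel (inl i)).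
Definition wKt_x (j : 'I_n) : abel wKt := ab_cls (pres_gen wKt_rel (inr j)).

(* The unique M with (a_1, ..., a_n) M = (x_1, ..., x_n).                     *)
Definition wTYM_diag : 'M[group_ring Lam]_n :=
  xget 0 [set M : 'M[group_ring Lam]_n |
          forall j, wKt_x j = \sum_i M i j *: wKt_a i].

End Representation.

(* The three invariants do not depend on the diagram; they are computed from  *)
(* an arbitrarily chosen one.                                                 *)
Section Invariants.
Variables (n : nat) (L : wSL n).

Definition vlk (i j : 'I_n) : int := vlk_diag (repr L) i j.
Definition V (i j : 'I_n) : int := V_diag (repr L) i j.
Definition wTYM : 'M[group_ring Lam]_n := wTYM_diag (repr L).

End Invariants.

Local Open Scope classical_set_scope.

Definition ker_wTYM (n : nat) : set (wSL n) := @wTYM n @^-1` [set 1%:M].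

(* Main.v *)
(* The string starting at the i-th top point picks up the exponent            *)
(*   E_i = (sum_k vl_ki, sum_k vl_ik, - sum_k V_ki)  (self-crossings included),*)
(* where the diagonal term of the third sum cancels, and                      *)
(* c_i = E_i - k_i (u + v) is the same triple with the sums over k != i.      *)
(* Mapping wK to Z[Lambda] by the accumulated exponents shows that            *)
(* w_j = E_(i_j), and mapping wKt to the free module shows that the j-th      *)
(* column of wTYM has the single entry c_(i_j), in row i_j.  Hence a trivial  *)
(* matrix forces all c_i = 0.                                                 *)
(*                                                                            *)
(* Conversely, c_i = 0 for all i also forces i_j = j: counting the strands to *)
(* the left of a point of the i-th string with signs (downwards +, upwards -) *)
(* gives a height that goes from i to the index of the end point and changes  *)
(* by L(e) at a crossing where the exponent e is picked up, with              *)
(* L(a, b, c) = a - b - c.  So end(i) - i = L(E_i) = L(c_i), as L(u + v) = 0. *)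
Require Import Defs.
From HB Require Import structures.
From mathcomp Require Import all_boot all_order all_algebra.
From mathcomp Require Import finmap monalg.
From mathcomp Require Import boolp classical_sets.
From mathcomp Require Import zify.
Import GRing.Theory.
Local Open Scope ring_scope.
Local Open Scope classical_set_scope.

(** * Strings of a diagram *)

(** Follow the string that starts at the i-th top point. Let [string_exp] be the exponent that it
    accumulates, and [net_exp] the same after removing (uv)^k, k being its number of signed
    self-crossings. Summing over crossings instead of along the string ([string_exp_cross]) shows
    that the coordinates of [net_exp] are the three sums of the theorem, up to a sign in the third
    ([net_expE]). The relations of wK carry the accumulated exponent from the top edge to the bottom
    edge, and an evaluation in Z[Lambda] excludes any other exponent ([wexpE]). An evaluation in a
    free module then shows that the matrix is monomial: column j has as its only entry the [net_exp]
    of the string ending at j, in the row of that string ([wTYM_diagE]).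

    So an identity matrix makes every [net_exp] trivial. The converse must also recover the
    permutation: the linear form [drift] of the accumulated exponent is the displacement of the
    string ([height_step], [string_end]), and it vanishes on u + v, so a trivial [net_exp] brings
    each string back below its start ([wTYM_diag_eq1]).

    All this rests on [step] being a reversible walk, whose orbits from the top meet a node at most
    once and in one direction only ([step_reverse], [visit_inj], [visit_reverse]). *)

Section Strings.
Set Implicit Arguments.
Unset Strict Implicit.
Unset Printing Implicit Defensive.
Local Open Scope nat_scope.

Variables (n : nat) (w : seq slice).
Implicit Types (x y z : node * bool).

Definition reverse x : node * bool := (x.1, ~~ x.2).

Lemma reverseK : involutive reverse.
Proof. by case=> p d; rewrite /reverse /= negbK. Qed.

Lemma mirrorK : involutive mirror.
Proof. by case=> [[]]. Qed.

(** A strand that gets through a slice comes back through the mirror image; one that turns comes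
    back through the same slice. *)
Lemma pass_reverse s p q b : pass s p = (q, b) ->
  pass (if b then mirror s else s) q = (p, b).
Proof.
case: s => [[l||] i] /=; rewrite /pass /=.
- by case=> <- <- /=; rewrite /pass /=; congr pair; repeat case: eqP; lia.
- case=> <- <-; rewrite /pass /=; case: (ltnP p i) => h; first by rewrite h;
  repeat (case: eqP => ?; first by lia).
  by case: ltnP => ?; repeat case: eqP => ?; try lia; congr pair; lia.
- case: eqP => [->|h1]; first by case=> <- <-; rewrite /pass /= eqxx ifF //; lia.
  case: eqP => [->|h2]; first by case=> <- <-; rewrite /pass /= eqxx.
  case=> <- <-; rewrite /pass /=; case: (ltnP p i) => h; first by rewrite h.
  by rewrite ifF; [congr pair|]; lia.
Qed.

(** Reversibility of the walk. The bound excludes points below the diagram, from which [step] can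
    climb but not return. *)
Lemma step_reverse x y : x.1.1 <= size w -> step w x = Some y ->
  step w (reverse y) = Some (reverse x) /\ y.1.1 <= size w.
Proof.
case: x => [[k p] []] /= hk.
  case: ifP => // lt_k; case E: (pass _ _) => [q []] [<-]; have := pass_reverse E.
    by rewrite /reverse /= => ->.
  by rewrite /reverse /= lt_k => ->.
case: k hk => // k hk; case E: (pass _ _) => [q []] [<-]; have := pass_reverse E.
  by rewrite /reverse /= mirrorK hk => ->; rewrite ltnW.
by rewrite /reverse /= => ->.
Qed.

Lemma pass_lt s m p q b : s.2 + strands_in s.1 <= m -> p < m -> pass s p = (q, b) ->
  q < (if b then m - strands_in s.1 + strands_out s.1 else m).
Proof.
case: s => [[l||] i] /=; rewrite /pass /=.
- move=> hi hp [<- <-]; do 2?case: eqP => ?; lia.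
- by move=> hi hp [<- <-] /=; case: (ltnP p i) => ?; lia.
- by move=> hi hp; do 2?case: eqP => ?; move=> [<- <-] /=; try case: (ltnP p i) => ?; lia.
Qed.

Lemma widthS k : k < size w ->
  width n w k.+1 = width n w k - strands_in (slice_at w k).1 + strands_out (slice_at w k).1.
Proof. by move=> hk; rewrite /width (take_nth (Cap, 0)) // foldl_rcons. Qed.

Hypothesis wlink : string_link n w.

Let wfit : fits n w n. Proof. by case/and3P: wlink. Qed.

Lemma width0 : width n w 0 = n.
Proof. by rewrite /width take0. Qed.

Lemma width_size : width n w (size w) = n.
Proof. by rewrite /width take_size (fits_width wfit). Qed.

Lemma slice_fits k : k < size w ->
  (slice_at w k).2 + strands_in (slice_at w k).1 <= width n w k.
Proof.
rewrite /width /slice_at; move: wfit; move: {1 3}n => m.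
elim: w k m => // s v IH [|k] m /=; first by case/andP.
by case/andP=> _ fv hk; apply: IH.
Qed.

Lemma step_is_node x y : is_node n w x.1 -> step w x = Some y -> is_node n w y.1.
Proof.
case: x => [[k p] []]; rewrite /is_node /= => /andP[le_k lt_p].
  case: ifP => // lt_k; case E: (pass _ _) => [q b].
  have := pass_lt (slice_fits lt_k) lt_p E; rewrite -(widthS lt_k).
  by case: b E => E lt_q [<-] /=; rewrite ?lt_k ?le_k.
case: k le_k lt_p => // k lt_k lt_p; case E: (pass _ _) => [q b].
have fk := slice_fits lt_k; have wk := widthS lt_k.
have /pass_lt/(_ lt_p E) :
  (mirror (slice_at w k)).2 + strands_in (mirror (slice_at w k)).1 <= width n w k.+1.
  by rewrite wk /mirror; case: (slice_at w k) fk => [[]] //=; lia.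
by case: b E => E lt_q [<-] /=; rewrite /is_node /= ?lt_k ?(ltnW lt_k) //=;
   move: lt_q; rewrite wk /mirror; case: (slice_at w k) fk => [[]] //=; lia.
Qed.


(** The orbit behind [trace], without the bound; it stays [None] once the string has ended. *)
Definition visit j t : option (node * bool) :=
  iter t (obind (step w)) (Some (0, j, true)).

Definition trace_bound := 2 * sumn [seq width n w k | k <- iota 0 (size w).+1].

Lemma traceP j x :
  reflect (exists2 t, t < trace_bound & visit j t = Some x) (x \in trace n w j).
Proof.
rewrite /trace mem_pmap map_id.
by apply: (iffP trajectP) => -[t lt_t]; exists t.
Qed.

Lemma visit_prev j t y : visit j t.+1 = Some y ->
  exists2 x, visit j t = Some x & step w x = Some y.
Proof. by rewrite /visit iterS; case: (iter _ _ _) => //= x h; exists x. Qed.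

Lemma visit_next j t x : visit j t = Some x -> visit j t.+1 = step w x.
Proof. by rewrite /visit iterS => ->. Qed.

Lemma visit_level j t x : visit j t = Some x -> x.1.1 <= size w.
Proof.
elim: t x => [|t IH] y; first by case=> <-.
by case/visit_prev => x /IH hx /(step_reverse hx)[].
Qed.

Lemma step_inj x y z : x.1.1 <= size w -> y.1.1 <= size w ->
  step w x = Some z -> step w y = Some z -> x = y.
Proof.
move=> hx hy /(step_reverse hx)[+ _] /(step_reverse hy)[+ _] => -> /Some_inj e.
exact: (inv_inj reverseK).
Qed.

Lemma step_start x j : x.1.1 <= size w -> step w x = Some (0, j, true) -> False.
Proof. by move=> hx /(step_reverse hx)[]. Qed.

(** Walk both orbits backwards by [step_inj]: neither start has a predecessor, so both are reached
    at the same time. *)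
Lemma visit_inj j j' t t' x :
  visit j t = Some x -> visit j' t' = Some x -> j = j' /\ t = t'.
Proof.
elim: t t' x => [|t IH] [|t'] x.
- by move=> [<-] [->].
- by move=> [<-] /visit_prev[y /visit_level hy /(step_start hy)].
- by move=> + [e]; rewrite -e => /visit_prev[y /visit_level hy /(step_start hy)].
move=> /visit_prev[y vy sy] /visit_prev[z vz sz].
have e := step_inj (visit_level vz) (visit_level vy) sz sy; rewrite {}e in vz.
by have [-> ->] := IH _ _ vy vz.
Qed.

Lemma visit_stop j t x r : visit j t = Some x -> step w x = None ->
  visit j (t + r.+1) = None.
Proof.
move=> vx sx; elim: r => [|r IH]; first by rewrite addn1 (visit_next vx).
by rewrite addnS /visit iterS -/(visit _ _) IH.
Qed.

Lemma step_bottom q : step w (size w, q, true) = None.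
Proof. by rewrite /= ltnn. Qed.

Lemma visit_bottom_uniq j t t' q q' : visit j t = Some (size w, q, true) ->
  visit j t' = Some (size w, q', true) -> t = t' /\ q = q'.
Proof.
move=> v v'; case: (ltngtP t t') => [lt|lt|e].
- by move: v'; rewrite -(subnK lt) addnC addSnnS (visit_stop _ v) ?step_bottom.
- by move: v; rewrite -(subnK lt) addnC addSnnS (visit_stop _ v') ?step_bottom.
- by move: v'; rewrite -e v => -[].
Qed.

(** The walk stops at the bottom point that [string_link] provides within the bound, so [trace]
    misses no visit. *)
Lemma visit_end j : j < n -> exists T q, [/\ T < trace_bound,
  visit j T = Some (size w, q, true) & forall t x, visit j t = Some x -> t <= T].
Proof.
move=> lt_j; have /and3P[_ /allP/(_ j) + _] := wlink.
rewrite mem_iota /= => /(_ lt_j)/hasP[[[k q] d] /traceP[T lt_T vT] /= /andP[/eqP ek ed]].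
rewrite ek ed in vT; exists T, q; split=> // t x vx; rewrite leqNgt; apply/negP => lt_Tt.
by move: vx; rewrite -(subnK lt_Tt) addnC addSnnS (visit_stop _ vT) ?step_bottom.
Qed.

(** Move [x] forward along [j] while its reverse moves back along [j']. When the latter reaches its
    start, string [j] leaves through the top, although it has to end at the bottom. *)
Lemma visit_reverse j j' t t' x : j < n -> j' < n ->
  visit j t = Some x -> visit j' t' = Some (reverse x) -> False.
Proof.
move=> lt_j lt_j'; have [T [q [_ vT maxT]]] := visit_end lt_j.
elim: t' t x => [|t' IH] t x vx; last first.
  case/visit_prev => z vz /(step_reverse (visit_level vz))[].
  rewrite reverseK => sx _; apply: (IH t.+1 (reverse z)); last by rewrite reverseK.
  by rewrite (visit_next vx).
move=> /Some_inj ex; have {}ex : x = (0, j', false) by rewrite -[x]reverseK -ex.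
subst x; have := maxT _ _ vx; rewrite leq_eqVlt => /orP[/eqP e|lt_t].
  by move: vx; rewrite e vT.
by move: vT; rewrite -(subnK lt_t) addnC addSnnS (visit_stop _ vx).
Qed.

Lemma visit_in_trace j t x : j < n -> visit j t = Some x -> x \in trace n w j.
Proof.
move=> lt_j vx; have [T [q [lt_T _ maxT]]] := visit_end lt_j.
by apply/traceP; exists t => //; apply: leq_ltn_trans lt_T; apply: maxT vx.
Qed.

Lemma start_in_trace j : j < n -> (0, j, true) \in trace n w j.
Proof. by move=> lt_j; apply: (@visit_in_trace _ 0). Qed.

Lemma trace_next j x y : j < n -> x \in trace n w j -> step w x = Some y ->
  y \in trace n w j.
Proof.
move=> lt_j /traceP[t _ vx] sx; apply: (@visit_in_trace _ t.+1) => //.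
by rewrite (visit_next vx).
Qed.

Lemma trace_prev j y : j < n -> y \in trace n w j ->
  y = (0, j, true) \/ exists2 x, x \in trace n w j & step w x = Some y.
Proof.
move=> lt_j /traceP[[|t] _]; first by case=> <-; left.
by move=> /visit_prev[x vx sx]; right; exists x => //; apply: visit_in_trace vx.
Qed.

Lemma trace_string_uniq i j x : x \in trace n w i -> x \in trace n w j -> i = j.
Proof. by move=> /traceP[t _ vx] /traceP[t' _ /(visit_inj vx)[]]. Qed.

Lemma trace_reverse i j x : i < n -> j < n ->
  x \in trace n w i -> reverse x \in trace n w j -> False.
Proof.
move=> lt_i lt_j /traceP[t _ vx] /traceP[t' _ vx'].
exact: visit_reverse vx vx'.
Qed.

Lemma visit_is_node j t x : j < n -> visit j t = Some x -> is_node n w x.1.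
Proof.
move=> lt_j; elim: t x => [|t IH] y.
  by case=> <-; rewrite /is_node /= width0.
by case/visit_prev => x /IH; apply: step_is_node.
Qed.

Lemma trace_is_node j x : j < n -> x \in trace n w j -> is_node n w x.1.
Proof. by move=> lt_j /traceP[t _]; apply: visit_is_node. Qed.

Lemma node_in_trace p : is_node n w p ->
  exists2 j, j < n & ((p, true) \in trace n w j) || ((p, false) \in trace n w j).
Proof.
case: p => k p /andP[/= lt_k lt_p].
have mem : (k, p) \in all_nodes n w.
  apply/allpairsPdep; exists k, p; rewrite !mem_iota.
  by split => //; rewrite add0n ltnS.
have /and3P[_ _ /allP/(_ _ mem)/hasP[j]] := wlink.
by rewrite mem_iota => lt_j h; exists j.
Qed.

Lemma uniq_trace j : uniq (trace n w j).
Proof.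
suff h m s : uniq (pmap id (traject (obind (step w)) (visit j s) m)) by exact: (h _ 0).
elim: m s => [|m IH] s //=; have := IH s.+1; rewrite {1 2}/visit iterS -/(visit j s).
case E: (visit j s) => [x|] //= ->; rewrite andbT mem_pmap map_id.
apply/trajectP => -[t lt_t]; rewrite -E -(visit_next E) /visit -iterD => e.
have [_] := visit_inj E (etrans (esym e) E); lia.
Qed.

Lemma step_trace j x y : j < n -> x.1.1 <= size w -> step w x = Some y ->
  (x \in trace n w j) = (y \in trace n w j).
Proof.
move=> lt_j hx sx; apply/idP/idP => [xj|]; first exact: trace_next sx.
case/trace_prev => // [ey|[z zj sz]]; first by rewrite ey in sx; case: (step_start hx sx).
by rewrite (step_inj hx _ sx sz) //; case/andP: (trace_is_node lt_j zj).
Qed.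

Lemma step_reverse_trace j x y : j < n -> x.1.1 <= size w -> step w x = Some y ->
  (reverse x \in trace n w j) = (reverse y \in trace n w j).
Proof.
by move=> lt_j hx /(step_reverse hx)[sy hy]; rewrite (step_trace lt_j _ sy).
Qed.

Lemma trace_downward j x : j < n -> x \in trace n w j -> downward n w x.1 = x.2.
Proof.
move=> lt_j; case: x => p [] xj.
  by apply/hasP; exists j => //; rewrite mem_iota.
apply/negbTE/hasPn => i; rewrite mem_iota => lt_i; apply/negP => xi.
exact: trace_reverse lt_i lt_j xi xj.
Qed.

Lemma downwardP p : reflect (exists2 j, j < n & (p, true) \in trace n w j) (downward n w p).
Proof. by apply: (iffP hasP) => -[j]; rewrite ?mem_iota => ? ?; exists j; rewrite ?mem_iota. Qed.

Lemma upwardP p : is_node n w p ->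
  reflect (exists2 j, j < n & (p, false) \in trace n w j) (~~ downward n w p).
Proof.
move=> hp; apply: (iffP idP) => [dp|[j lt_j /(trace_downward lt_j)/= -> //]].
have [j lt_j /orP[pj|pj]] := node_in_trace hp; last by exists j.
by rewrite (trace_downward lt_j pj) in dp.
Qed.

Lemma downward_through k p q : k < size w -> pass (slice_at w k) p = (q, true) ->
  downward n w (k.+1, q) = downward n w (k, p).
Proof.
move=> lt_k e; have s : step w (k, p, true) = Some (k.+1, q, true) by rewrite /= lt_k e.
by apply/downwardP/downwardP => -[j lt_j h]; exists j => //;
  move: h; rewrite (@step_trace _ (k, p, true) _ lt_j (ltnW lt_k) s).
Qed.

Lemma downward_turn k p q d : k <= size w -> is_node n w (k, p) -> is_node n w (k, q) ->
  step w (k, p, d) = Some (k, q, ~~ d) -> downward n w (k, p) = ~~ downward n w (k, q).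
Proof.
move=> le_k np nq s; have st j (lt_j : j < n) := @step_trace _ (k, p, d) _ lt_j le_k s.
have rst j (lt_j : j < n) := @step_reverse_trace _ (k, p, d) _ lt_j le_k s.
by case: d {s} st rst => st rst; apply/downwardP/(upwardP nq) => -[j lt_j h]; exists j => //;
  [rewrite -st | rewrite st | have := rst _ lt_j; rewrite /reverse /= => <-
  | have := rst _ lt_j; rewrite /reverse /= => ->].
Qed.

(** * Horizontal position along a string *)

Definition dir (p : node) : int := (if downward n w p then 1 else -1)%R.

(** With signs, the two legs of a maximum or minimum to the left cancel. *)
Definition level_sum k p : int := (\sum_(q < p) dir (k, q : nat))%R.

Lemma level_sumS k p : level_sum k p.+1 = (level_sum k p + dir (k, p))%R.
Proof. by rewrite /level_sum big_ord_recr. Qed.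

Lemma dir_through k p q : k < size w -> pass (slice_at w k) p = (q, true) ->
  dir (k.+1, q) = dir (k, p).
Proof. by move=> lt_k e; rewrite /dir (downward_through lt_k e). Qed.

Lemma dir_cap k : k < size w -> (slice_at w k).1 = Cap ->
  (dir (k.+1, (slice_at w k).2) + dir (k.+1, (slice_at w k).2.+1) = 0)%R.
Proof.
move=> lt_k; have := slice_fits lt_k; have := widthS lt_k.
case E: (slice_at w k) => [g i] /= + + eg; rewrite {}eg /= in E *.
move=> wk hi; rewrite /dir (@downward_turn k.+1 i i.+1 false) //.
- by case: (downward _ _ _).
- by rewrite /is_node /= lt_k wk; lia.
- by rewrite /is_node /= lt_k wk; lia.
- by rewrite /= E /mirror /pass /= eqxx.
Qed.

Lemma dir_cup k : k < size w -> (slice_at w k).1 = Cup ->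
  (dir (k, (slice_at w k).2) + dir (k, (slice_at w k).2.+1) = 0)%R.
Proof.
move=> lt_k; have := slice_fits lt_k.
case E: (slice_at w k) => [g i] /= + eg; rewrite {}eg /= in E *.
move=> hi; rewrite /dir (@downward_turn k i i.+1 true) //.
- by case: (downward _ _ _).
- exact: ltnW.
- by rewrite /is_node /= (ltnW lt_k); lia.
- by rewrite /is_node /= (ltnW lt_k); lia.
- by rewrite /= lt_k E /pass /= eqxx.
Qed.

Lemma dir_cross k l : k < size w -> (slice_at w k).1 = Cross l ->
  dir (k.+1, (slice_at w k).2) = dir (k, (slice_at w k).2.+1) /\
  dir (k.+1, (slice_at w k).2.+1) = dir (k, (slice_at w k).2).
Proof.
move=> lt_k; case E: (slice_at w k) => [g i] /= eg; rewrite {}eg in E.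
by split; apply: dir_through => //; rewrite E /pass /= eqxx // ifF //; apply/eqP; lia.
Qed.

Lemma level_sum_left k p : k < size w -> p <= (slice_at w k).2 ->
  level_sum k.+1 p = level_sum k p.
Proof.
move=> lt_k; elim: p => [|p IH] lt_p; first by rewrite /level_sum !big_ord0.
rewrite !level_sumS IH; last exact: ltnW.
congr (_ + _)%R; apply: dir_through => //.
case: (slice_at w k) lt_p => [[l||] i] /= lt_p; rewrite /pass /=.
- by rewrite !ifF //; apply/eqP; lia.
- by rewrite lt_p.
- by rewrite lt_p !ifF //; apply/eqP; lia.
Qed.

(** A crossing exchanges two directions and an extremum has opposite ones, so the piece contributes
    equally above and below. *)
Lemma level_sum_right k r : k < size w ->
  level_sum k.+1 ((slice_at w k).2 + strands_out (slice_at w k).1 + r) =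
  level_sum k ((slice_at w k).2 + strands_in (slice_at w k).1 + r).
Proof.
move=> lt_k; have := level_sum_left lt_k (leqnn _).
have := @dir_cross k; have := @dir_cap k lt_k; have := @dir_cup k lt_k.
have := @dir_through k.
elim: r => [|r IH].
  rewrite !addn0; case: (slice_at w k) => [[l||] i] /= _ cup cap cross e.
  - by rewrite !addn2 !level_sumS e; have [-> ->] := cross l lt_k erefl; rewrite addrAC.
  - by rewrite addn2 addn0 !level_sumS e -addrA cap ?addr0.
  - by rewrite addn2 addn0 !level_sumS e -addrA cup ?addr0.
move=> thr cup cap cross e; rewrite !addnS !level_sumS IH //; congr (_ + _)%R.
apply: thr => //; case: (slice_at w k) => [[l||] i] /=; rewrite /pass /=.
- by rewrite !ifF //; apply/eqP; lia.
- by rewrite ifF; [congr pair|]; lia.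
- by rewrite !ifF; [congr pair| | |]; lia.
Qed.

Local Open Scope ring_scope.

(** The exponent belongs to the strand: it is the same whichever way the strand is run through. *)
Definition expUL k : Lam :=
  match (slice_at w k).1 with
  | Cross Over => lam_v *~ csign n w k
  | Cross Under => lam_u *~ csign n w k
  | Cross Virt => if parallel n w k then - lam_alpha else lam_alpha
  | _ => 0
  end.

Definition expUR k : Lam :=
  match (slice_at w k).1 with
  | Cross Over => lam_u *~ csign n w k
  | Cross Under => lam_v *~ csign n w k
  | Cross Virt => if parallel n w k then lam_alpha else - lam_alpha
  | _ => 0
  end.

Lemma pass_exp_down k p : pass_exp n w (k, p, true) =
  if p == (slice_at w k).2 then expUL k
  else if p == (slice_at w k).2.+1 then expUR k else 0.
Proof.
by rewrite /pass_exp /expUL /expUR; case: (slice_at w k) => [[[]||] i] //=; do 2?case: ifP.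
Qed.

Lemma pass_exp_up k p : pass_exp n w (k.+1, p, false) =
  if p == (slice_at w k).2.+1 then expUL k
  else if p == (slice_at w k).2 then expUR k else 0.
Proof.
by rewrite /pass_exp /expUL /expUR; case: (slice_at w k) => [[[]||] i] //=; do 2?case: ifP.
Qed.

(* A strand moves by one position, to the right or to the left, at each       *)
(* crossing; the functional is chosen so that it reads this off the exponent  *)
(* picked up there.                                                           *)
Definition drift (l : Lam) : int := l.1.1 - l.1.2 - l.2.

Lemma driftD : {morph drift : a b / a + b}.
Proof. by case=> [[a b] c] [[a' b'] c']; rewrite /drift /=; lia. Qed.

Lemma dir_neq0 p : dir p = 1 \/ dir p = -1.
Proof. by rewrite /dir; case: ifP; [left|right]. Qed.

(** The drift depends only on the directions of the two strands, not on the label of the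
    crossing. *)
Lemma drift_cross k l : (slice_at w k).1 = Cross l ->
  let s := dir (k, (slice_at w k).2) * dir (k, (slice_at w k).2.+1) in
  drift (expUL k) = s /\ drift (expUR k) = - s.
Proof.
rewrite /expUL /expUR /csign /parallel /dir => -> /=.
by case: l; do 2?case: (downward _ _ _).
Qed.

Lemma pass_exp_through k p q : pass (slice_at w k) p = (q, true) ->
  pass_exp n w (k.+1, q, false) = pass_exp n w (k, p, true).
Proof.
rewrite pass_exp_up pass_exp_down /expUL /expUR.
case: (slice_at w k) => [[l||] i] /=; rewrite /pass /=; try by rewrite !if_same.
case=> <-; have [_|pi] := eqVneq p i; first by rewrite eqxx.
have [_|pi1] := eqVneq p i.+1; last by rewrite (negPf pi) (negPf pi1).
by rewrite ifF ?eqxx //; apply/eqP; lia.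
Qed.

(** Only a crossing changes the count, by plus or minus the direction of the other strand. Since
    directions square to 1, multiplying the drift by [dir (k, p)] isolates that direction. *)
Lemma level_sum_through k p q : (k < size w)%N -> pass (slice_at w k) p = (q, true) ->
  level_sum k.+1 q = level_sum k p + dir (k, p) * drift (pass_exp n w (k, p, true)).
Proof.
move=> lt_k; rewrite pass_exp_down.
have drift0 : drift 0 = 0 by [].
case: (ltnP p (slice_at w k).2) => [lt_p|le_p].
  rewrite (_ : pass _ _ = (p, true)).
    case=> <-; rewrite level_sum_left //; last exact: ltnW.
    by rewrite !ifF ?drift0 ?mulr0 ?addr0 //; apply/eqP; lia.
  rewrite /pass; case: (slice_at w k) lt_p => [[l||] i] /= lt_p;
    last by rewrite lt_p !ifF //; apply/eqP; lia.
    by rewrite !ifF //; apply/eqP; lia.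
  by rewrite lt_p.
have := level_sum_left lt_k (leqnn _); have := level_sum_right _ lt_k.
have := dir_cross lt_k; have := @drift_cross k; rewrite /expUL /expUR.
case: (slice_at w k) le_p => [[l||] i] /= le_p; rewrite /pass /= => dr dirS right left.
- have [drL drR] := dr l erefl; have [dU dL] := dirS l erefl.
  case=> <-; have [->|pi] := eqVneq p i.
    by rewrite level_sumS left drL dU; case: (dir_neq0 (k, i)) => ->; lia.
  have [->|pi1] := eqVneq p i.+1.
    by rewrite level_sumS left drR; case: (dir_neq0 (k, i.+1)) => ->; lia.
  by have := right (p - i.+2)%N; rewrite addn2 subnKC ?drift0 => [->|]; lia.
- rewrite ltnNge le_p /= => -[<-]; have := right (p - i)%N.
  by rewrite addn2 addn0 addSn addSn subnKC // !if_same drift0; lia.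
case: eqP => // pi; case: eqP => // pi1; rewrite ltnNge le_p /= => -[<-].
have := right (p - i.+2)%N; rewrite addn0 addn2 subnKC ?drift0; last by lia.
by rewrite (_ : (i + (p - i.+2) = p - 2)%N); lia.
Qed.

(* At a local extremum the strand turns between adjacent points, and the      *)
(* correction for upward strands makes the height constant there.             *)
Definition height x : int := level_sum x.1.1 x.1.2 - (if x.2 then 0 else 1).

Lemma height_step j x y : (j < n)%N -> x \in trace n w j -> step w x = Some y ->
  height y = height x + drift (pass_exp n w x).
Proof.
move=> lt_j xj; have := trace_downward lt_j xj; have := trace_is_node lt_j xj.
move eP: (pass_exp n w x) => P.
case: x xj eP => [[k p] []] xj eP /andP[/= le_k lt_p] dp.
  case: ifP => // lt_k; case e: (pass _ _) => [q []] [<-]; rewrite /height /=.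
    by rewrite (level_sum_through lt_k e) eP /dir dp; lia.
  have := pass_exp_down k p; rewrite eP; move: e (dir_cup lt_k); rewrite /expUL /expUR.
  case: (slice_at w k) => [[l||] i] /=; rewrite /pass //= !if_same => e /(_ erefl) + ->.
  have : dir (k, p) = 1 by rewrite /dir dp.
  have -> : drift 0 = 0 by [].
  by case: eqP e => [->|_]; [|case: eqP => [->|_]] => -[<-] //=; rewrite level_sumS; lia.
case: k xj eP le_k lt_p dp => // k xj eP lt_k lt_p dp.
case e: (pass _ _) => [q []] [<-]; rewrite /height /=.
  have := pass_reverse e; rewrite mirrorK => e'.
  rewrite (level_sum_through lt_k e') -(pass_exp_through e') eP.
  by rewrite -(dir_through lt_k e') /dir dp; lia.
have := pass_exp_up k p; rewrite eP; move: e (dir_cap lt_k); rewrite /expUL /expUR /mirror.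
case: (slice_at w k) => [[l||] i] /=; rewrite /pass //= !if_same => e /(_ erefl) + ->.
have : dir (k.+1, p) = -1 by rewrite /dir dp.
have -> : drift 0 = 0 by [].
by case: eqP e => [->|_]; [|case: eqP => [->|_]] => -[<-] //=; rewrite level_sumS; lia.
Qed.

Definition partial_exp j t : Lam :=
  \sum_(s < t) oapp (pass_exp n w) 0 (visit j s).

Definition string_exp j : Lam := \sum_(x <- trace n w j) pass_exp n w x.

Lemma partial_exp_recr j t :
  partial_exp j t.+1 = partial_exp j t + oapp (pass_exp n w) 0 (visit j t).
Proof. exact: big_ord_recr. Qed.

Lemma partial_expS j t x : visit j t = Some x ->
  partial_exp j t.+1 = partial_exp j t + pass_exp n w x.
Proof. by rewrite partial_exp_recr => ->. Qed.

(** A string going up from the bottom would have to come from somewhere, but the reversed point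
    admits no step. *)
Lemma bottom_downward q : (q < n)%N -> downward n w (size w, q).
Proof.
move=> lt_q; apply/negPn/negP => /upwardP h.
have [|j lt_j] := h; first by rewrite /is_node /= leqnn width_size.
case/trace_prev => // -[x xj] /step_reverse[|+ _].
  by case/andP: (trace_is_node lt_j xj).
by rewrite /= ltnn.
Qed.

Lemma top_downward q : (q < n)%N -> downward n w (0%N, q).
Proof. by move=> lt_q; apply/downwardP; exists q => //; apply: start_in_trace. Qed.

Lemma level_sum_downward k p : (forall q, (q < p)%N -> downward n w (k, q)) ->
  level_sum k p = p.
Proof.
move=> h; rewrite /level_sum (eq_bigr (fun=> 1)); last by move=> q _; rewrite /dir h.
by rewrite sumr_const card_ord pmulrn intz.
Qed.

Lemma visit_height j t x : (j < n)%N -> visit j t = Some x ->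
  height x = j%:Z + drift (partial_exp j t).
Proof.
move=> lt_j; elim: t x => [|t IH] y vy.
  case: vy => <-; rewrite /partial_exp big_ord0 /height level_sum_downward //=.
  by move=> q lt_q; apply: top_downward; apply: ltn_trans lt_j.
have [x vx sx] := visit_prev vy.
rewrite (height_step lt_j (visit_in_trace lt_j vx) sx) (IH _ vx) -addrA -driftD.
by rewrite -partial_expS.
Qed.

(** At the top and at the bottom all strands point downwards, so heights there are plain
    positions. *)
Lemma string_end j : (j < n)%N -> exists T q,
  [/\ (q < n)%N, visit j T = Some (size w, q, true),
      string_exp j = partial_exp j T & q%:Z = j%:Z + drift (string_exp j)].
Proof.
move=> lt_j; have [T [q [lt_T vT maxT]]] := visit_end lt_j.
have lt_q : (q < n)%N.
  by have /andP[_ /=] := visit_is_node lt_j vT; rewrite width_size.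
suff e : string_exp j = partial_exp j T.
  exists T, q; split=> //; rewrite e -(visit_height lt_j vT) /height level_sum_downward ?subr0 //.
  by move=> p lt_p; apply: bottom_downward; apply: ltn_trans lt_q.
have sumE m s : \sum_(x <- pmap id (traject (obind (step w)) (visit j s) m)) pass_exp n w x =
    \sum_(r < m) oapp (pass_exp n w) 0 (visit j (s + r)).
  elim: m s => [|m IH] s; first by rewrite big_nil big_ord0.
  rewrite big_ord_recl /= addn0.
  under [in RHS]eq_bigr do rewrite /bump /= add1n -addSnnS.
  rewrite -IH (_ : visit j s.+1 = obind (step w) (visit j s)) //.
  by case: (visit j s) => [x|] /=; rewrite ?big_cons ?add0r.
have -> : string_exp j = partial_exp j trace_bound := sumE _ 0%N.
rewrite -(subnKC lt_T); move: (_ - _)%N => r; elim: r => [|r IH].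
  (* The bottom point reads the default slice, a [Cap], and thus contributes 0. *)
  rewrite addn0 (partial_expS vT) /pass_exp /slice_at nth_default ?addr0 //.
rewrite addnS partial_exp_recr IH.
case E: (visit j _) => [x|] /=; last by rewrite addr0.
by have /= := maxT _ _ E; rewrite leqNgt ltnS leq_addr.
Qed.

(** * Exponents and linking numbers *)

Lemma string_throughP j p : (j < n)%N ->
  (string_through n w p == Some j) =
  ((p, true) \in trace n w j) || ((p, false) \in trace n w j).
Proof.
move=> lt_j; rewrite /string_through.
set P := fun i => _ || _; rewrite -/(P j).
have Pj i : (i < n)%N -> P i -> P j -> i = j.
  rewrite /P => lt_i /orP[] pi /orP[] pj; try exact: trace_string_uniq pi pj.
    by case: (trace_reverse lt_i lt_j pi pj).
  by case: (trace_reverse lt_i lt_j pi pj).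
apply/eqP/idP => [|Pj0].
  case E: [seq _ <- _ | _] => [|i s] //= -[<-].
  by have: i \in i :: s; [rewrite inE eqxx | rewrite -E mem_filter => /andP[]].
have: j \in [seq i <- iota 0 n | P i] by rewrite mem_filter Pj0 mem_iota.
case E: [seq _ <- _ | _] => [|i s] //= _.
have: i \in i :: s by rewrite inE eqxx.
by rewrite -E mem_filter mem_iota => /andP[Pi lt_i]; rewrite (Pj i).
Qed.

Lemma node_string p : is_node n w p ->
  exists i : 'I_n, string_through n w p = Some (i : nat).
Proof.
move=> /node_in_trace[i lt_i h]; exists (Ordinal lt_i).
by apply/eqP; rewrite string_throughP.
Qed.

(** Both terms are present at a self-crossing. *)
Definition cross_exp j k : Lam :=
  expUL k *+ (stringUL n w k == Some j) + expUR k *+ (stringUR n w k == Some j).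

Lemma sum_indicator (V : zmodType) (T : eqType) (s : seq T) (a : T) (c : V) :
  uniq s ->
  \sum_(x <- s) c *+ (x == a) = c *+ (a \in s).
Proof.
move=> us; have [sa|nsa] := boolP (a \in s).
  by rewrite (bigD1_seq a) //= eqxx big1 ?addr0 // => x /negPf->.
by rewrite big1_seq // => x /= sx; case: eqP => // e; rewrite -e sx in nsa.
Qed.

Arguments pass_exp : simpl never.

(** The four indicators are the two strands of a slice, each entered from above or from below. In
    this form the sum along the string can be exchanged with the sum over slices. *)
Lemma pass_exp_sum j x : (j < n)%N -> x \in trace n w j ->
  pass_exp n w x = \sum_(k < size w)
    (expUL k *+ (x == (k : nat, (slice_at w k).2, true))
     + expUL k *+ (x == (k.+1, (slice_at w k).2.+1, false))
     + expUR k *+ (x == (k : nat, (slice_at w k).2.+1, true))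
     + expUR k *+ (x == (k.+1, (slice_at w k).2, false))).
Proof.
move=> lt_j xj; have /andP[+ _] := trace_is_node lt_j xj.
case: x xj => [[k p] []] xj /= lt_k.
  move: lt_k; rewrite leq_eqVlt => /orP[/eqP ek|lt_k].
    rewrite pass_exp_down big1 => [|i _].
      have [-> ->] : expUL k = 0 /\ expUR k = 0.
        by rewrite /expUL /expUR /slice_at nth_default // ek.
      by rewrite !if_same.
    by rewrite !xpair_eqE !andbF /= ek !(gtn_eqF (ltn_ord i)) !mulr0n !addr0.
  rewrite (bigD1 (Ordinal lt_k)) //= big1 ?addr0 => [|i ne_i].
    rewrite pass_exp_down !xpair_eqE /= !eqxx !andbT !andbF !mulr0n !addr0.
    by case: eqP => [->|_]; case: eqP => // ?; rewrite ?addr0 ?add0r //; lia.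
  have h : (k == i) = false by apply/negbTE; apply: contra ne_i => /eqP h; apply/eqP/val_inj.
  by rewrite !xpair_eqE h !andbF /= !mulr0n !addr0.
case: k xj lt_k => [|k] xj lt_k.
  (* There is no slice above level 0, yet [k.-1] would read slice 0; no string runs upwards at a top
     point. *)
  have /andP[_ /=] := trace_is_node lt_j xj; rewrite width0 => lt_p.
  by case: (trace_reverse lt_j lt_p xj (start_in_trace lt_p)).
rewrite (bigD1 (Ordinal lt_k)) //= big1 ?addr0 => [|i ne_i].
  rewrite pass_exp_up !xpair_eqE /= !eqxx !andbT !andbF !mulr0n !add0r !addr0.
  by case: eqP => [->|_]; case: eqP => // ?; rewrite ?addr0 ?add0r //; lia.
have h : (k == i) = false by apply/negbTE; apply: contra ne_i => /eqP h; apply/eqP/val_inj.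
by rewrite !xpair_eqE !eqSS h !andbF /= !mulr0n !addr0.
Qed.

Lemma string_exp_cross j : (j < n)%N -> string_exp j = \sum_(k < size w) cross_exp j k.
Proof.
move=> lt_j; rewrite /string_exp big_seq.
under eq_bigr => x xj do rewrite (pass_exp_sum lt_j xj).
rewrite -big_seq exchange_big; apply: eq_bigr => k _ /=.
rewrite !big_split /= !sum_indicator ?uniq_trace //.
rewrite /cross_exp /stringUL /stringUR !string_throughP //.
have lt_k := ltn_ord k; move: {k}(k : nat) lt_k => k lt_k.
case E: (slice_at w k) => [[l||] i] /=; try by rewrite /expUL /expUR E !mul0rn !addr0.
have sL : step w (k, i, true) = Some (k.+1, i.+1, true).
  by rewrite /= lt_k E /pass /= eqxx.
have sR : step w (k, i.+1, true) = Some (k.+1, i, true).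
  by rewrite /= lt_k E /pass /= eqxx ifF //; apply/eqP; lia.
(* Upward passages are moved from the lower to the upper end of each strand, where [string_through]
   is read. *)
have := @step_reverse_trace _ (k, i, true) _ lt_j (ltnW lt_k) sL.
have := @step_reverse_trace _ (k, i.+1, true) _ lt_j (ltnW lt_k) sR.
rewrite /reverse /= => <- <-.
have comb (V : zmodType) (c : V) p :
  c *+ ((p, true) \in trace n w j) + c *+ ((p, false) \in trace n w j) =
  c *+ (((p, true) \in trace n w j) || ((p, false) \in trace n w j)).
  case E1: (_ \in _); case E2: (_ \in _); rewrite /= ?addr0 ?add0r //.
  by case: (trace_reverse lt_j lt_j E1 E2).
by rewrite -!comb !addrA.
Qed.

Lemma lam_mulz (a : Lam) (m : int) : a *~ m = (a.1.1 * m, a.1.2 * m, a.2 * m).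
Proof.
rewrite [LHS]surjective_pairing [(a *~ m).1]surjective_pairing -!mulrzz.
by rewrite (raddfMz fst) (raddfMz snd) (raddfMz fst) (raddfMz snd).
Qed.

Lemma cross_exp_u j k : (cross_exp j k).1.1 =
  csign n w k *+ (classical w k && (under_string n w k == Some j)).
Proof.
clear wfit wlink; rewrite /cross_exp /expUL /expUR /classical /under_string !lam_mulz.
case: (slice_at w k) => [[[]||] i]; case: (_ == Some j); case: (_ == Some j);
  by rewrite /= ?if_same /=; try case: ifP => _ //=; lia.
Qed.

Lemma cross_exp_v j k : (cross_exp j k).1.2 =
  csign n w k *+ (classical w k && (over_string n w k == Some j)).
Proof.
clear wfit wlink; rewrite /cross_exp /expUL /expUR /classical /over_string !lam_mulz.
case: (slice_at w k) => [[[]||] i]; case: (_ == Some j); case: (_ == Some j);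
  by rewrite /= ?if_same /=; try case: ifP => _ //=; lia.
Qed.

Lemma cross_exp_alpha j k : (cross_exp j k).2 =
  1 *+ (virtual w k && (rtl_string n w k == Some j))
  - 1 *+ (virtual w k && (ltr_string n w k == Some j)).
Proof.
clear wfit wlink; rewrite /cross_exp /expUL /expUR /virtual /rtl_string /ltr_string !lam_mulz.
case: (slice_at w k) => [[[]||] i]; case: (parallel n w k);
  case: (_ == Some j); case: (_ == Some j); by rewrite /=; lia.
Qed.

Lemma crossing_strings k l : (k < size w)%N -> (slice_at w k).1 = Cross l ->
  exists i i' : 'I_n, stringUL n w k = Some (i : nat) /\ stringUR n w k = Some (i' : nat).
Proof.
move=> lt_k; have := slice_fits lt_k; rewrite /stringUL /stringUR.
case: (slice_at w k) => [g i] /= + eg; rewrite {}eg /= => fk.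
have [|a ->] := @node_string (k, i); first by rewrite /is_node /= (ltnW lt_k); lia.
have [|b ->] := @node_string (k, i.+1); first by rewrite /is_node /= (ltnW lt_k); lia.
by exists a, b.
Qed.

End Strings.

(** * Accumulated exponents as sums of linking numbers *)

Section Exponents.
Set Implicit Arguments.
Unset Strict Implicit.
Unset Printing Implicit Defensive.

Arguments cross_exp : simpl never.
Arguments string_exp : simpl never.

Variables (n : nat) (D : diagram n).
Let w : seq slice := val D.
Let wlink : string_link n w := valP D.
Implicit Types i j : 'I_n.

Lemma sum_other_string (a b : bool) (c : int) (o : option nat) :
  (a -> exists i, o = Some (i : nat)) ->
  \sum_(i < n) c *+ [&& a, o == Some (i : nat) & b] = c *+ (a && b).
Proof.
case: a => [[] // i ->|_]; last by rewrite big1.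
rewrite (bigD1 i) //= eqxx big1 ?addr0 // => i' ne.
rewrite (_ : (_ == _) = false) //; apply/eqP => -[e].
by move: ne; rewrite -(inj_eq val_inj) /= e eqxx.
Qed.

Lemma sum_crossings (P : 'I_(size w) -> bool) (F : 'I_(size w) -> int) :
  \sum_(k | P k) F k = \sum_k F k *+ P k.
Proof. by rewrite big_mkcond; apply: eq_bigr => k _; case: (P k). Qed.

Lemma classical_strings k : (k < size w)%N -> classical w k ->
  (exists i, over_string n w k = Some (i : nat)) /\
  (exists i, under_string n w k = Some (i : nat)).
Proof.
move=> lt_k; rewrite /classical => cl.
have [l el] : exists l, (slice_at w k).1 = Cross l.
  by case/orP: cl => /eqP ->; [exists Over | exists Under].
have [a [b [ea eb]]] := crossing_strings wlink lt_k el.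
rewrite /over_string /under_string ea eb.
by case: ifP => _; split; [exists a|exists b|exists b|exists a].
Qed.

Lemma virtual_strings k : (k < size w)%N -> virtual w k ->
  (exists i, ltr_string n w k = Some (i : nat)) /\
  (exists i, rtl_string n w k = Some (i : nat)).
Proof.
move=> lt_k /eqP el.
have [a [b [ea eb]]] := crossing_strings wlink lt_k el.
rewrite /ltr_string /rtl_string ea eb.
by case: ifP => _; split; [exists a|exists b|exists b|exists a].
Qed.

Lemma sum_vlk_under j : \sum_i vlk_diag D i j = (string_exp n w j).1.1.
Proof.
rewrite (string_exp_cross wlink) // !raddf_sum.
rewrite /vlk_diag; under eq_bigr do rewrite sum_crossings.
rewrite exchange_big; apply: eq_bigr => k _; rewrite [RHS]cross_exp_u.
by apply: sum_other_string => /(classical_strings (ltn_ord k))[].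
Qed.

Lemma sum_vlk_over j : \sum_i vlk_diag D j i = (string_exp n w j).1.2.
Proof.
rewrite (string_exp_cross wlink) // !raddf_sum.
rewrite /vlk_diag; under eq_bigr do rewrite sum_crossings.
rewrite exchange_big; apply: eq_bigr => k _; rewrite [RHS]cross_exp_v.
rewrite -(@sum_other_string _ _ _ (under_string n w k)).
  by apply: eq_bigr => i _; congr (_ *+ nat_of_bool (_ && _)); rewrite andbC.
by move=> /(classical_strings (ltn_ord k))[].
Qed.

(** Here [j] is the string being passed: what [V_diag] counts positively is a left-to-right passage
    of [j], which contributes alpha^-1. *)
Lemma sum_V j : \sum_i V_diag D i j = - (string_exp n w j).2.
Proof.
have sumE (f g : nat -> option nat) :
    (forall k : 'I_(size w), virtual w k -> exists i, f k = Some (i : nat)) ->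
    \sum_(i < n) \sum_(k < size w | [&& virtual w k, f k == Some (i : nat)
                                      & g k == Some (j : nat)]) 1
    = \sum_(k < size w) 1 *+ (virtual w k && (g k == Some (j : nat))) :> int.
  move=> fP; under eq_bigr do rewrite sum_crossings.
  by rewrite exchange_big; apply: eq_bigr => k _; apply: sum_other_string; apply: fP.
rewrite /V_diag sumrB !sumE; try by move=> k /(virtual_strings (ltn_ord k))[].
rewrite (string_exp_cross wlink) // (raddf_sum snd) -sumrB -sumrN; apply: eq_bigr => k _.
by rewrite -[RHS]/(- (cross_exp n w j k).2) cross_exp_alpha opprB.
Qed.

Lemma V_diagii j : V_diag D j j = 0.
Proof.
apply/eqP; rewrite /V_diag subr_eq0; apply/eqP; apply: eq_bigl => k.
by rewrite [X in _ && X]andbC.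
Qed.

Definition net_exp j : Lam :=
  string_exp n w j - (lam_u + lam_v) *~ self_crossings D j.

(** The diagonal term of both classical sums is [self_crossings D j], which the factor in u + v
    removes; in the virtual sum it is 0. *)
Lemma net_expE j : net_exp j =
  (\sum_(i < n | i != j) vlk_diag D i j, \sum_(i < n | i != j) vlk_diag D j i,
   - \sum_(i < n | i != j) V_diag D i j).
Proof.
rewrite /net_exp lam_mulz /=.
pose su : int := \sum_(i < n | i != j) vlk_diag D i j.
pose so : int := \sum_(i < n | i != j) vlk_diag D j i.
pose sV : int := \sum_(i < n | i != j) V_diag D i j.
pose s : int := self_crossings D j.
have eu : s + su = (string_exp n w j).1.1 by rewrite -sum_vlk_under (bigD1 j).
have eo : s + so = (string_exp n w j).1.2 by rewrite -sum_vlk_over (bigD1 j).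
have eV : sV = - (string_exp n w j).2 by rewrite -sum_V (bigD1 j) //= V_diagii add0r.
rewrite -/(su, so, - sV) -/s; move: su so sV s eu eo eV => su so sV s.
case: (string_exp n w j) => [[a b] c] /= eu eo eV.
congr (_, _, _).
- by rewrite -[LHS]/(a - (1 + 0) * s); lia.
- by rewrite -[LHS]/(b - (0 + 1) * s); lia.
- by rewrite -[LHS]/(c - (0 + 0) * s); lia.
Qed.

End Exponents.

(** * The presented modules *)

Section PresentationValue.
Set Implicit Arguments.
Unset Strict Implicit.
Unset Printing Implicit Defensive.

Variables (A : zmodType) (X : choiceType) (V : zmodType) (f : X -> A -> V).

(** [f x a] is the value given to x^a. Once the translated relations are respected, this is a
    homomorphism that tells elements of the presented group apart. *)
Definition word_value (s : word A X) : V :=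
  \sum_(l <- s) (if l.2 then f l.1.1 l.1.2 else - f l.1.1 l.1.2).

Lemma word_value_cat s t : word_value (s ++ t) = word_value s + word_value t.
Proof. exact: big_cat. Qed.

Lemma word_value1 x a : word_value [:: (x, a, true)] = f x a.
Proof. exact: big_seq1. Qed.

Variable R : word A X -> word A X -> Prop.
Hypothesis fR : forall s t w, R s t ->
  word_value (translate w s) = word_value (translate w t).

Lemma word_value_pres s t : pres_eq R s t -> word_value s = word_value t.
Proof.
elim=> {s t} //.
- by move=> s t r _ -> _ ->.
- by move=> s s' t t' _ es _ et; rewrite !word_value_cat es et.
- move=> [p b]; rewrite /word_value big_cons big_seq1 big_nil.
  by case: b => /=; rewrite ?subrr ?addNr.
Qed.

Definition pres_value (g : presented R) : V := word_value (repr (g : pres_group R)).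

Lemma pres_value_cls s : pres_value (pres_cls R s) = word_value s.
Proof. exact: word_value_pres (pres_repr R s). Qed.

Lemma pres_valueM g h : pres_value (g * h)%g = pres_value g + pres_value h.
Proof.
elim/pres_ind: g => s; elim/pres_ind: h => t.
by rewrite -[(_ * _)%g]/(pres_mul _ _) pres_mulE !pres_value_cls word_value_cat.
Qed.

Lemma pres_value1 : pres_value 1%g = 0.
Proof. by rewrite -[1%g]/(pres_cls R [::]) pres_value_cls /word_value big_nil. Qed.

Lemma pres_valueV g : pres_value g^-1%g = - pres_value g.
Proof.
by apply: (addrI (pres_value g)); rewrite -pres_valueM mulgV pres_value1 subrr.
Qed.

Lemma pres_value_derived g : in_derived g -> pres_value g = 0.
Proof.
elim=> {g}; rewrite ?pres_value1 //.
- move=> g h; rewrite /commg /conjg !pres_valueM !pres_valueV.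
  by rewrite addrA -opprD addNr.
- by move=> g h _ eg _ eh; rewrite pres_valueM eg eh addr0.
- by move=> g _ eg; rewrite pres_valueV eg oppr0.
Qed.

Definition abel_value (x : abel (presented R)) : V := pres_value (repr x).

Lemma abel_value_cls g : abel_value (ab_cls g) = pres_value g.
Proof.
have := pres_value_derived (ab_repr g); rewrite pres_valueM pres_valueV.
by move/eqP; rewrite subr_eq0 => /eqP.
Qed.

Lemma abel_value_additive :
  exists F : {additive abel (presented R) -> V}, F =1 abel_value.
Proof.
have lin : {morph abel_value : x y / x - y}.
  elim/ab_ind=> g; elim/ab_ind=> h.
  have -> : - ab_cls h = ab_cls h^-1%g by rewrite -ab_oppE.
  by rewrite -ab_clsM !abel_value_cls pres_valueM pres_valueV.
pose phi := GRing.isZmodMorphism.Build _ _ _ lin.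
pose F : {additive abel (presented R) -> V} := HB.pack abel_value phi.
by exists F.
Qed.

End PresentationValue.

(** * Linear evaluations in modules over the group ring *)

Section FreeValue.
Set Implicit Arguments.
Unset Strict Implicit.
Unset Printing Implicit Defensive.

Variables (A : zmodType) (X : choiceType) (V : lmodType (group_ring A)).
Variables (v : X -> V) (R : word A X -> word A X -> Prop).

Definition gr_basis (a : A) : group_ring A := << a >>.

Lemma gr_basisD a b : gr_basis (a + b) = gr_basis a * gr_basis b.
Proof. by rewrite -[RHS]/(gr_mul << a >> << b >>) gr_mulUU mulr1. Qed.

Lemma gr_basis_inj : injective gr_basis.
Proof.
move=> a b e; have := mcoeffU a (1 : int) b; rewrite -[<< a >>]/(gr_basis a) e.
by rewrite mcoeffUU; case: eqP.
Qed.

Lemma gr_basis_neq0 a : gr_basis a != 0.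
Proof. by rewrite monalgU_eq0. Qed.

Lemma scale_gr_basis (G : actGroup A) (g : G) a :
  gr_basis a *: ab_cls g = ab_cls (aact g a).
Proof. by rewrite -ab_actE -[LHS]/(ab_scale _ _) ab_scaleU. Qed.

Let f x a := gr_basis a *: v x.
Hypothesis fR : forall s t w, R s t ->
  word_value f (translate w s) = word_value f (translate w t).

Lemma word_value_translate w s : word_value f (translate w s) = gr_basis w *: word_value f s.
Proof.
rewrite /word_value big_map scaler_sumr; apply: eq_bigr => -[[x a] b] _ /=.
by rewrite /f addrC gr_basisD -scalerA; case: b; rewrite ?scalerN.
Qed.

(** By additivity it suffices to treat basis elements of the group ring, where this is equivariance
    under translation. *)
Lemma abel_valueZ c (x : abel (presented R)) :
  abel_value f (c *: x) = c *: abel_value f x.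
Proof.
have act a : abel_value f (ab_act a x) = gr_basis a *: abel_value f x.
  elim/ab_ind: x => g; rewrite ab_actE !abel_value_cls //; elim/pres_ind: g => s.
  by rewrite -[aact _ _]/(pres_act _ _) pres_actE !pres_value_cls // word_value_translate.
have [F FE] := abel_value_additive fR.
rewrite -!FE -[c *: x]/(ab_scale c x) /ab_scale raddf_sum.
rewrite [X in X *: _](monalgE (c : {malg int[A]})) scaler_suml; apply: eq_bigr => a _.
rewrite raddfMz !FE act.
rewrite scalerMzl; congr (_ *: _); apply/malgP => b.
by rewrite (raddfMz (mcoeff b)) /= !mcoeffU; case: (a == b); rewrite ?mul0rz ?intz.
Qed.

Lemma abel_value_lincomb (I : finType) (c : I -> group_ring A)
    (x : I -> abel (presented R)) :
  abel_value f (\sum_i c i *: x i) = \sum_i c i *: abel_value f (x i).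
Proof.
have [F FE] := abel_value_additive fR.
by rewrite -FE raddf_sum; apply: eq_bigr => i _; rewrite FE abel_valueZ.
Qed.

End FreeValue.

(** * The exponents w_j of wK *)

Section Exponent.
Set Implicit Arguments.
Unset Strict Implicit.
Unset Printing Implicit Defensive.

Variables (n : nat) (D : diagram n).
Let w : seq slice := val D.
Let wlink : string_link n w := valP D.
Implicit Types i j : 'I_n.

Lemma string_to_trace j : (size w, j : nat, true) \in trace n w (string_to D j).
Proof.
rewrite /string_to; case: pickP => [i //|none].
have /downwardP[i lt_i ij] := bottom_downward wlink (ltn_ord j).
by have := none (Ordinal lt_i); rewrite ij.
Qed.

Lemma string_to_uniq i j :
  (size w, j : nat, true) \in trace n w i -> string_to D j = i.
Proof. by move=> ij; apply/val_inj/(trace_string_uniq (string_to_trace j) ij). Qed.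

Lemma string_to_surj i : exists j, string_to D j = i.
Proof.
have [T [q [lt_q vT _ _]]] := string_end wlink (ltn_ord i).
exists (Ordinal lt_q); apply: string_to_uniq; exact: visit_in_trace vT.
Qed.

Lemma string_to_visit j : exists2 T,
  visit w (string_to D j) T = Some (size w, j : nat, true)
  & string_exp n w (string_to D j) = partial_exp n w (string_to D j) T.
Proof.
have [T [q [_ vT eT _]]] := string_end wlink (ltn_ord (string_to D j)).
have /(traceP n)[t _ vt] := string_to_trace j.
by have [e _] := visit_bottom_uniq vt vT; exists T; rewrite // -e.
Qed.

Lemma string_to_drift j :
  (j : nat)%:Z = (string_to D j : nat)%:Z + drift (string_exp n w (string_to D j)).
Proof.
have [T [q [_ vT _ <-]]] := string_end wlink (ltn_ord (string_to D j)).
have /(traceP n)[t _ vt] := string_to_trace j.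
by have [_ ->] := visit_bottom_uniq vt vT.
Qed.

(** Well defined at visited nodes, since each is met by one string, once and in one direction
    ([node_expE]). *)
Definition node_exp (p : node) : Lam := xget 0
  [set l | exists j t d, visit w (j : 'I_n) t = Some (p, d) /\ l = partial_exp n w j t].

Lemma node_expE j t p d : visit w j t = Some (p, d) -> node_exp p = partial_exp n w j t.
Proof.
move=> v; apply: xget_unique; first by exists j, t, d.
move=> l [j' [t' [d' [v' ->]]]].
have ed : d' = d.
  apply/eqP/negPn/negP => ne; apply: (visit_reverse wlink (ltn_ord j) (ltn_ord j') v (t' := t')).
  by rewrite v' /reverse /=; case: d d' ne {v v'} => [] [].
by move: v'; rewrite ed => /(visit_inj v)[-> ->].
Qed.

Lemma pres_gen_act (X : choiceType) (R : word Lam X -> word Lam X -> Prop) x a :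
  aact (pres_gen R x) a = pres_cls R [:: (x, a, true)].
Proof. by rewrite -[LHS]/(pres_act _ _) pres_actE /= add0r. Qed.

Lemma edge_gen j t x (e : edge D) : visit w j t = Some x -> val e = x.1 ->
  pres_gen (@wK_rel n D) e
  = aact (pres_gen (@wK_rel n D) (top_edge D j) : wK D) (partial_exp n w j t).
Proof.
elim: t x e => [|t IH] y e vy ee.
  rewrite /partial_exp big_ord0 aact0; congr pres_gen; apply: val_inj.
  by rewrite ee; case: vy => <-.
have [x vx sx] := visit_prev vy.
pose e' : edge D := Sub x.1 (visit_is_node wlink (ltn_ord j) vx).
rewrite (partial_expS n vx) -aactD -(IH x e' vx) ?SubK // pres_gen_act.
have xj := visit_in_trace wlink (ltn_ord j) vx.
have := PE_rel 0 (WK_pass xj sx (SubK _ _ : val e' = x.1) ee).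
by rewrite !translate0 => h; apply/pres_clsP.
Qed.

Lemma wexpE j : wexp D j = string_exp n w (string_to D j).
Proof.
have [T vT eT] := string_to_visit j.
have top : pres_gen (@wK_rel n D) (bottom_edge D j)
  = aact (pres_gen (@wK_rel n D) (top_edge D (string_to D j)) : wK D)
      (string_exp n w (string_to D j)).
  by rewrite eT; apply: (edge_gen vT); rewrite SubK.
(* For uniqueness: this evaluation sends top edges to 1, and distinct exponents give distinct basis
   elements of Z[Lambda]. *)
pose f (e : edge D) a := gr_basis (node_exp (val e) + a).
have fR s t a : wK_rel s t -> word_value f (translate a s) = word_value f (translate a t).
  case=> i x y e e' xi sx ex ey; rewrite /translate /= !word_value1 /f /= ex ey.
  congr gr_basis; rewrite add0r addrA.
  have /(traceP n)[r _ vx] := xi.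
  have vy := visit_next vx; rewrite sx in vy.
  case: x y {xi ex ey} sx vx vy => [px dx] [py dy] sx vx vy.
  by rewrite (node_expE vx) (node_expE vy) (partial_expS n vx).
apply: xget_unique => [//|l]; rewrite /mkset top !pres_gen_act.
move=> /pres_clsP/(word_value_pres fR); rewrite !word_value1 /f => /gr_basis_inj e.
by rewrite (addrI _ e).
Qed.

End Exponent.

(** * The matrix and its kernel *)

Section Matrix.
Set Implicit Arguments.
Unset Strict Implicit.
Unset Printing Implicit Defensive.

Variables (n : nat) (D : diagram n).
Implicit Types i j : 'I_n.

Definition end_exp j : Lam :=
  wexp D j - (lam_u + lam_v) *~ self_crossings D (string_to D j).

Lemma end_expE j : end_exp j = net_exp D (string_to D j).
Proof. by rewrite /end_exp wexpE. Qed.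

(** The correction is a multiple of u + v, on which [drift] vanishes. *)
Lemma drift_net_exp i : drift (net_exp D i) = drift (string_exp n (val D) i).
Proof.
rewrite /net_exp lam_mulz; case: (string_exp _ _ _) => [[a b] c].
rewrite /drift -[LHS]/(a - (1 + 0) * self_crossings D i - (b - (0 + 1) * self_crossings D i)
  - (c - (0 + 0) * self_crossings D i)) /=.
by move: (self_crossings D i) a b c => s a b c; lia.
Qed.

Lemma wKt_xE j : wKt_x D j = gr_basis (end_exp j) *: wKt_a D (string_to D j).
Proof.
rewrite /wKt_a scale_gr_basis; congr ab_cls; rewrite pres_gen_act.
apply/pres_clsP; have := PE_rel 0 (WKt_end D j).
by rewrite !translate0.
Qed.

Definition gen_value (g : 'I_n + 'I_n) : 'rV[group_ring Lam]_n :=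
  match g with
  | inl i => delta_mx 0 i
  | inr j => gr_basis (end_exp j) *: delta_mx 0 (string_to D j)
  end.

Lemma wTYM_diagE : wTYM_diag D =
  \matrix_(i, j) (gr_basis (end_exp j) *+ (i == string_to D j)).
Proof.
apply: xget_unique => [j|M hM].
  rewrite wKt_xE (bigD1 (string_to D j)) //= mxE eqxx big1 ?addr0 // => i /negPf ne.
  by rewrite mxE ne scale0r.
(* Uniqueness of the matrix: [gen_value] sends the a_i to the standard basis, so the coefficients
   can be read off. *)
have fR s t a : @wKt_rel n D s t ->
    word_value (fun x a => gr_basis a *: gen_value x) (translate a s) =
    word_value (fun x a => gr_basis a *: gen_value x) (translate a t).
  case=> j; rewrite /translate /= !word_value1 /= scalerA -gr_basisD.
  by rewrite add0r addrC.
have valE g : abel_value (fun x a => gr_basis a *: gen_value x)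
    (ab_cls (pres_gen (@wKt_rel n D) g)) = gen_value g.
  by rewrite abel_value_cls // pres_value_cls // word_value1; apply: scale1r.
apply/matrixP => i j; rewrite [RHS]mxE.
have := congr1 (abel_value (fun x a => gr_basis a *: gen_value x) (R := _)) (hM j).
rewrite valE abel_value_lincomb //; under eq_bigr do rewrite valE.
move=> /(congr1 (fun r : 'rV__ => r 0 i)).
have -> : gen_value (inr j) 0 i = gr_basis (end_exp j) *+ (i == string_to D j).
  by rewrite [LHS]mxE [delta_mx _ _ _ _]mxE eqxx mulr_natr.
move=> ->; rewrite summxE (bigD1 i) //= [X in _ = X + _]mxE [delta_mx _ _ _ _]mxE.
rewrite !eqxx mulr1 big1 ?addr0 // => i' ne.
by rewrite [LHS]mxE [delta_mx _ _ _ _]mxE eq_sym (negPf ne) mulr0.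
Qed.

Lemma drift_end_exp j : (j : nat)%:Z = (string_to D j : nat)%:Z + drift (end_exp j).
Proof. by rewrite end_expE drift_net_exp -string_to_drift. Qed.

Lemma wTYM_diag_eq1 : wTYM_diag D = 1%:M <-> forall i, net_exp D i = 0.
Proof.
have coef i j : wTYM_diag D i j = gr_basis (end_exp j) *+ (i == string_to D j).
  by rewrite wTYM_diagE [LHS]mxE.
have coef1 i j : (1%:M : 'M[group_ring Lam]_n) i j = (i == j)%:R by rewrite [LHS]mxE.
split=> [eq1 i|net0].
  (* Compare the entry where string [i] ends: it is a group element, hence nonzero, so it lies on
     the diagonal and equals 1. *)
  have [j <-] := string_to_surj D i; rewrite -end_expE.
  have e := coef (string_to D j) j; rewrite eq1 coef1 eqxx mulr1n in e.
  move: e; case: eqP => [_ e|_ /esym/eqP]; last by rewrite (negPf (gr_basis_neq0 _)).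
  exact/esym/gr_basis_inj.
have end0 j : end_exp j = 0 by rewrite end_expE.
have st j : string_to D j = j.
  by apply: val_inj; have := drift_end_exp j; rewrite end0 addr0 => -[].
by apply/matrixP => i j; rewrite coef coef1 st end0.
Qed.

End Matrix.

Theorem theorem4p9 (n : nat) (hn : (2 <= n)%N) :
  @ker_wTYM n =
  [set L : wSL n | forall j : 'I_n,
     [/\ \sum_(i < n | i != j) vlk L i j = 0,
         \sum_(i < n | i != j) vlk L j i = 0
       & \sum_(i < n | i != j) V L i j = 0] ].
Proof.
apply/seteqP; split=> L.
  move/wTYM_diag_eq1 => net0 j; have := net0 j; rewrite net_expE => -[? ? /eqP].
  by rewrite oppr_eq0 => /eqP.
move=> sums0; apply/wTYM_diag_eq1 => j.
by have [eu eo eV] := sums0 j; rewrite net_expE; congr (_, _, _); rewrite ?eV ?oppr0.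
Qed.
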